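(* Let $f(z)$ be an entire function such that $f(0)=1$ and such that, for a positive number $A$, $$\limsup_{r\to\infty}\frac{\log M(r,f)}{\log^{A}r}<\infty .$$ Then $f(z)$ has infinitely many nonzero roots $\{\rho_n\}_{n\in\mathbb{N}}$ such that $$0<|\rho_1|\le|\rho_2|\le\cdots\le|\rho_n|\le\cdots .$$ Let $C$ be any positive number satisfying $$C>\limsup_{r\to\infty}\frac{\log M(r,f)}{\log^{A}r}.$$ Then the following hold. (1) Case $0<A\le 1$. For any such $C$ there exists a positive integer $N$ such that $$|\rho_n|>e^{2(2C)^{1/A}n^{1/A}},\qquad \forall n\ge N .$$ (2) Case $A>1$. For any such $C$ and any $\eta$ with $0<\eta<1$ there exists a positive integer $N$ such that $$|\rho_n|\ge e^{C(\eta,A,C)\,n^{1/(A-1)}},\qquad \forall n\ge N,$$ where $C(\eta,A,C)$ is defined by $$C(\eta,A,C)=\left(\frac{(1-\eta)\eta^{A}}{C}\right)^{\frac{1}{A-1}} .$$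
   Context: For an entire function $f$ and $r>0$, $M(r,f)=\sup\{|f(z)|:|z|\le r\}$. The notation $\log^{A}r$ means $(\log r)^{A}$. The roots $\rho_n$ are the zeros of $f$, counted with multiplicity and indexed by $n=1,2,3,\dots$ in order of nondecreasing modulus.
   Formalization: The claim that f has infinitely many nonzero roots is made only for f that is not a polynomial (it fails for f = 1); the bounds (1) and (2) are stated for every listing of the roots, finite or infinite, at those indices n ≥ N for which ρ_n exists. *)

(* Defs.v *)
(* Stdlib world: Stdlib reals with Coquelicot's complex numbers. *)
From Stdlib Require Import Reals List.
From Coquelicot Require Import Coquelicot.

Open Scope R_scope.

(* [ex_derive] is taken here over the complex numbers as scalars:
   this is complex differentiability, not real differentiability. *)
Definition entire (f : C -> C) : Prop :=
  forall z : C, @ex_derive C_AbsRing C_NormedModule f z.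

Definition is_polynomial (f : C -> C) : Prop :=
  exists (d : nat) (a : nat -> C),
    forall z : C, f z = sum_n (fun k => (a k * z ^ k)%C) d.

(* [real] only discards the infinite values of the supremum, which do not occur
   for [0 <= r] and [f] continuous. *)
Definition M (r : R) (f : C -> C) : R :=
  real (Lub_Rbar (fun x => exists z : C, Cmod z <= r /\ x = Cmod (f z))).

(* limsup as r tends to +oo: the infimum over B of the supremum over r > B. *)
Definition LimSup_infty (g : R -> R) : Rbar :=
  Rbar_glb (fun s => exists B : R,
    s = Lub_Rbar (fun x => exists r : R, B < r /\ x = g r)).

(* Only large r matter, where ln r > 0 and [Rpower (ln r) A] is (log r)^A. *)
Definition growth (f : C -> C) (A : R) : Rbar :=
  LimSup_infty (fun r => ln (M r f) / Rpower (ln r) A).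

(* f vanishes at z to order exactly m; m = 0 means that f z is nonzero. *)
Definition zero_order (f : C -> C) (z : C) (m : nat) : Prop :=
  exists g : C -> C,
    entire g /\ g z <> RtoC 0 /\ forall w : C, f w = ((w - z) ^ m * g w)%C.

(* Indices start at 1; [None] stands for an infinite list of roots,
   [Some k] for a list of length k. *)
Definition listed (K : option nat) (n : nat) : Prop :=
  (1 <= n)%nat /\ match K with Some k => (n <= k)%nat | None => True end.

(* rho lists all the zeros of f, in order of nondecreasing modulus, each point z
   being listed exactly as many times as its order as a zero of f (so not at all
   when f z is nonzero). Values of rho at unlisted indices are irrelevant. *)
Definition zeros_listing (f : C -> C) (K : option nat) (rho : nat -> C) : Prop :=
  (forall m n : nat, listed K m -> listed K n -> (m <= n)%nat ->
     Cmod (rho m) <= Cmod (rho n)) /\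
  (forall z : C, exists l : list nat,
     NoDup l /\
     (forall n : nat, In n l <-> listed K n /\ rho n = z) /\
     zero_order f z (length l)).

Definition C_const (eta A c : R) : R :=
  Rpower ((1 - eta) * Rpower eta A / c) (1 / (A - 1)).

(* Main.v *)
Require Import Defs.
From Stdlib Require Import Reals List Lra Lia Classical ClassicalEpsilon.
From Coquelicot Require Import Coquelicot.

(** Both halves of the theorem rest on Jensen's inequality. If
    [f(w) = (w - a_1) ... (w - a_n) g(w)] with [f(0) = 1], then replacing each
    [w - a_k] by [r - conj(a_k) w / r] changes no modulus on the circle of radius
    [r], and the maximum modulus principle at the centre gives
    [r ^ n <= |a_1| ... |a_n| M(r)] ([blaschke_bound], [jensen_log]). With
    [x = log r] and the growth hypothesis this reads
    [n (x - log |rho_n|) < c x ^ A] for all large [x] ([listed_zero_bound]). When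
    [A <= 1], letting [x] tend to infinity forces [n <= c], so that only finitely
    many zeros exist ([few_zeros]); when [A > 1], the choice
    [x = log |rho_n| / eta] yields the lower bound ([zeros_lower_bound]).

    For the existence of infinitely many zeros, suppose that finitely many roots
    can be split off so that the cofactor [g] has no zero. Then [g'/g] is entire
    and has a primitive [L] with [Re L = log |g|] up to a constant, and [Re L] is
    bounded above by [O(log^A r)] on circles. Carathéodory's inequality bounds
    [|L'(a)| r] by twice such a bound, for every centre [a] and all large [r]
    ([caratheodory]); as [log^A r = O(sqrt r)], [L' = 0], so [g] is constant and
    [f] is a polynomial ([zero_free_constant], [cofactor_has_zero]). Hence zeros can
    be split off forever, each time one of least modulus. Jensen's inequality
    bounds the number of zeros in every disc, with multiplicity, so least moduli
    are attained ([minimal_zero]) and the resulting list exhausts every zero with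
    its order ([listing_exists]).

    The function theory behind this is derived from complex differentiability alone.
    Goursat's theorem is proved for [C^1] images of rectangles ([goursat]). An
    annulus swept from the circle to a point gives Cauchy's formula
    ([cauchy_formula]), whence derivatives of entire functions are entire, zeros
    can be divided out, and mean values are available; a cone over a segment gives
    primitives ([entire_primitive]). *)

(** * Continuity and derivatives of complex-valued functions *)

Lemma continuous_C {U : UniformSpace} (f : U -> C) (x : U) :
  continuous (U := C_UniformSpace) f x <->
  continuous (fun y => Re (f y)) x /\ continuous (fun y => Im (f y)) x.
Proof.
  split.
  - intros Hf. split.
    + exact (continuous_comp (V := C_UniformSpace) f (fun z : C => fst z) x Hf
               (continuous_fst (U:=R_UniformSpace) (V:=R_UniformSpace) _ _)).
    + exact (continuous_comp (V := C_UniformSpace) f (fun z : C => snd z) x Hf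
               (continuous_snd (U:=R_UniformSpace) (V:=R_UniformSpace) _ _)).
  - intros [H1 H2].
    apply continuous_ext with (fun y => (Re (f y), Im (f y)) : C).
    { intros y; unfold Re, Im; now destruct (f y). }
    apply (continuous_comp_2 (fun y => Re (f y)) (fun y => Im (f y))
      (fun a b : R => (a, b) : C_UniformSpace) x H1 H2).
    apply continuous_ext with (fun p : R * R => p : C_UniformSpace).
    { now intros []. }
    apply continuous_id.
Qed.

Lemma continuous_Cmult {U : UniformSpace} (f g : U -> C) (x : U) :
  continuous (U := C_UniformSpace) f x -> continuous (U := C_UniformSpace) g x ->
  continuous (U := C_UniformSpace) (fun y => Cmult (f y) (g y)) x.
Proof.
  rewrite !continuous_C. intros [f1 f2] [g1 g2]. split; simpl.
  - apply (continuous_minus (fun y => Re (f y) * Re (g y)) (fun y => Im (f y) * Im (g y)));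
      now apply (continuous_mult (K := R_AbsRing)).
  - apply (continuous_plus (fun y => Re (f y) * Im (g y)) (fun y => Im (f y) * Re (g y)));
      now apply (continuous_mult (K := R_AbsRing)).
Qed.

Lemma continuous_Cplus {U : UniformSpace} (f g : U -> C) (x : U) :
  continuous (U := C_UniformSpace) f x -> continuous (U := C_UniformSpace) g x ->
  continuous (U := C_UniformSpace) (fun y => Cplus (f y) (g y)) x.
Proof.
  rewrite !continuous_C. intros [f1 f2] [g1 g2]. split; simpl.
  - now apply (continuous_plus (fun y => Re (f y)) (fun y => Re (g y))).
  - now apply (continuous_plus (fun y => Im (f y)) (fun y => Im (g y))).
Qed.

Lemma continuous_Copp {U : UniformSpace} (f : U -> C) (x : U) :
  continuous (U := C_UniformSpace) f x ->
  continuous (U := C_UniformSpace) (fun y => Copp (f y)) x.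
Proof.
  rewrite !continuous_C. intros [f1 f2]. split; simpl.
  - now apply (continuous_opp (fun y => Re (f y))).
  - now apply (continuous_opp (fun y => Im (f y))).
Qed.

Lemma continuous_Cminus {U : UniformSpace} (f g : U -> C) (x : U) :
  continuous (U := C_UniformSpace) f x -> continuous (U := C_UniformSpace) g x ->
  continuous (U := C_UniformSpace) (fun y => Cminus (f y) (g y)) x.
Proof.
  intros Hf Hg. apply continuous_Cplus; auto. now apply continuous_Copp.
Qed.

Lemma continuous_Cinv {U : UniformSpace} (f : U -> C) (x : U) :
  continuous (U := C_UniformSpace) f x -> f x <> 0%C ->
  continuous (U := C_UniformSpace) (fun y => Cinv (f y)) x.
Proof.
  rewrite !continuous_C. intros [f1 f2] Hx.
  assert (Hn : fst (f x) ^ 2 + snd (f x) ^ 2 <> 0).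
  { intros H. apply Hx. destruct (f x) as [a b]; simpl in *.
    assert (a = 0 /\ b = 0) as [-> ->] by nra. reflexivity. }
  assert (Hsq : forall g : U -> R, continuous g x -> continuous (fun y => g y ^ 2) x).
  { intros g Hg. apply continuous_ext with (fun y => mult (g y) (g y)).
    - intros y. unfold mult; simpl. ring.
    - now apply (continuous_mult (K := R_AbsRing)). }
  assert (Hi : continuous (fun y => / (fst (f y) ^ 2 + snd (f y) ^ 2)) x).
  { apply (continuous_comp (fun y => fst (f y) ^ 2 + snd (f y) ^ 2) Rinv);
      [|now apply continuous_Rinv].
    apply (continuous_plus (fun y => fst (f y) ^ 2) (fun y => snd (f y) ^ 2)); now apply Hsq. }
  split; simpl.
  - now apply (continuous_mult (K := R_AbsRing) (fun y => fst (f y))).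
  - apply (continuous_mult (K := R_AbsRing) (fun y => - snd (f y))); auto.
    now apply (continuous_opp (fun y => snd (f y))).
Qed.

Lemma continuous_RtoC (x : R) : continuous (T := R_UniformSpace) (U := C_UniformSpace) RtoC x.
Proof.
  apply continuous_C; split; simpl; [apply continuous_id | apply continuous_const].
Qed.

Lemma C_ball_Cmod (z w : C) (e : R) : Cmod (w - z) < e -> ball (M := C_UniformSpace) z e w.
Proof. exact (C_NormedModule_mixin_compat1 z w e). Qed.

Lemma Cmod_C_ball (z w : C) (e : R) :
  0 < e -> ball (M := C_UniformSpace) z (e / 2) w -> Cmod (w - z) < e.
Proof.
  intros He [H1 H2].
  apply Rle_lt_trans with (1 := Cmod_2Rmax _).
  change (fst (w - z)%C) with (fst w - fst z). change (snd (w - z)%C) with (snd w - snd z).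
  change (Rabs (fst w - fst z) < e / 2) in H1.
  change (Rabs (snd w - snd z) < e / 2) in H2.
  assert (Hm : Rmax (Rabs (fst w - fst z)) (Rabs (snd w - snd z)) < e / 2)
    by now apply Rmax_lub_lt.
  assert (Hs : sqrt 2 < 2).
  { rewrite <- (sqrt_square 2) at 2 by lra. apply sqrt_lt_1; lra. }
  assert (0 <= sqrt 2) by apply sqrt_pos.
  assert (0 <= Rmax (Rabs (fst w - fst z)) (Rabs (snd w - snd z)))
    by (apply Rle_trans with (2 := Rmax_l _ _); apply Rabs_pos).
  nra.
Qed.

Lemma continuous_C_eps {U : UniformSpace} (f : U -> C) (x : U) :
  continuous (U := C_UniformSpace) f x <->
  forall e : R, 0 < e -> locally x (fun y => Cmod (f y - f x) < e).
Proof.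
  split.
  - intros Hf e He.
    assert (He2 : 0 < e / 2) by lra.
    generalize (proj1 (filterlim_locally _ _) Hf (mkposreal _ He2)).
    apply filter_imp. intros y Hy. now apply Cmod_C_ball.
  - intros Hf. apply filterlim_locally. intros e.
    generalize (Hf e (cond_pos e)). apply filter_imp. intros y. apply C_ball_Cmod.
Qed.

Lemma locally_C (z : C) (P : C -> Prop) :
  locally (T := C_UniformSpace) z P <->
  exists d : R, 0 < d /\ forall w, Cmod (w - z) < d -> P w.
Proof.
  split.
  - intros [d Hd]. exists d; split; [apply cond_pos|]. intros w Hw. apply Hd.
    now apply C_ball_Cmod.
  - intros [d [Hd H]]. assert (Hd2 : 0 < d / 2) by lra.
    exists (mkposreal _ Hd2). intros w Hw. apply H. now apply Cmod_C_ball.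
Qed.

Lemma continuous_C_C (f : C -> C) (z : C) :
  continuous (T := C_UniformSpace) (U := C_UniformSpace) f z ->
  forall e, 0 < e -> exists d, 0 < d /\ forall w, Cmod (w - z) < d -> Cmod (f w - f z) < e.
Proof.
  intros Hf e He. apply locally_C.
  exact (proj1 (continuous_C_eps (U := C_UniformSpace) f z) Hf e He).
Qed.

Lemma locally_R (x : R) (P : R -> Prop) :
  locally (T := R_UniformSpace) x P <->
  exists d : R, 0 < d /\ forall y, Rabs (y - x) < d -> P y.
Proof.
  split.
  - intros [d Hd]. exists d; split; [apply cond_pos|]. exact Hd.
  - intros [d [Hd H]]. exists (mkposreal _ Hd). exact H.
Qed.

(** Carathéodory's form of the derivative: the difference quotient extends
    continuously. With [iota] the identity of [C] it is the complex derivative,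
    with [iota] the inclusion of [R] it is the derivative of a curve; in this form
    the rules of calculus are algebraic identities and one proof serves both. *)
Definition cder {U : UniformSpace} (iota f : U -> C) (x : U) (l : C) : Prop :=
  exists phi : U -> C, continuous (U := C_UniformSpace) phi x /\ phi x = l /\
    forall y, f y = (f x + (iota y - iota x) * phi y)%C.

Definition Cderiv (f : C -> C) (z l : C) : Prop :=
  cder (U := C_UniformSpace) (fun w => w) f z l.

Definition Rderiv (f : R -> C) (x : R) (l : C) : Prop :=
  cder (U := R_UniformSpace) RtoC f x l.

Section Calculus.
Context {U : UniformSpace} (iota : U -> C).

Lemma cder_eq f x l l' : cder iota f x l -> l = l' -> cder iota f x l'.
Proof. now intros H <-. Qed.

Lemma cder_ext f g x l : (forall y, f y = g y) -> cder iota f x l -> cder iota g x l.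
Proof.
  intros H (phi & H1 & H2 & H3). exists phi; split; [|split]; auto.
  intros y. now rewrite <- !H.
Qed.

Lemma cder_const c x : cder iota (fun _ => c) x 0.
Proof.
  exists (fun _ => 0%C). split; [apply continuous_const|split]; auto. intros; ring.
Qed.

Lemma cder_id x : cder iota iota x 1.
Proof.
  exists (fun _ => 1%C). split; [apply continuous_const|split]; auto. intros; ring.
Qed.

Lemma cder_plus f g x l m :
  cder iota f x l -> cder iota g x m -> cder iota (fun y => (f y + g y)%C) x (l + m)%C.
Proof.
  intros (p & p1 & p2 & p3) (q & q1 & q2 & q3).
  exists (fun y => (p y + q y)%C). split; [now apply continuous_Cplus|split].
  - now rewrite p2, q2.
  - intros y. rewrite (p3 y), (q3 y). ring.
Qed.

Lemma cder_continuous f x l :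
  continuous (U := C_UniformSpace) iota x -> cder iota f x l ->
  continuous (U := C_UniformSpace) f x.
Proof.
  intros Hi (p & p1 & p2 & p3).
  apply continuous_ext with (fun y => (f x + (iota y - iota x) * p y)%C).
  { intros; symmetry; apply p3. }
  apply continuous_Cplus; [apply continuous_const|].
  apply continuous_Cmult; auto. apply continuous_Cminus; auto. apply continuous_const.
Qed.

Lemma cder_mult f g x l m :
  continuous (U := C_UniformSpace) iota x ->
  cder iota f x l -> cder iota g x m ->
  cder iota (fun y => (f y * g y)%C) x (l * g x + f x * m)%C.
Proof.
  intros Hi Hf Hg. assert (Hc := cder_continuous _ _ _ Hi Hg). revert Hf Hg.
  intros (p & p1 & p2 & p3) (q & q1 & q2 & q3).
  exists (fun y => (p y * g y + f x * q y)%C). split; [|split].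
  - apply continuous_Cplus; apply continuous_Cmult; auto. apply continuous_const.
  - now rewrite p2, q2.
  - intros y. rewrite (p3 y), (q3 y). ring.
Qed.

Lemma cder_opp f x l :
  cder iota f x l -> cder iota (fun y => (- f y)%C) x (- l)%C.
Proof.
  intros (p & p1 & p2 & p3).
  exists (fun y => (- p y)%C). split; [now apply continuous_Copp|split].
  - now rewrite p2.
  - intros y. rewrite (p3 y). ring.
Qed.

Lemma cder_minus f g x l m :
  cder iota f x l -> cder iota g x m -> cder iota (fun y => (f y - g y)%C) x (l - m)%C.
Proof. intros Hf Hg. apply cder_plus; auto. now apply cder_opp. Qed.

(** The difference quotient of [/ f] is [- phi / (f y * f x)]; where [f y]
    vanishes the value prescribed by the identity is taken instead. *)
Lemma cder_inv f x l :
  continuous (U := C_UniformSpace) iota x ->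
  cder iota f x l -> f x <> 0%C ->
  cder iota (fun y => (/ f y)%C) x (- l / (f x * f x))%C.
Proof.
  intros Hi Hf Hx. assert (Hc := cder_continuous _ _ _ Hi Hf).
  destruct Hf as (p & p1 & p2 & p3).
  set (q := fun y => (- p y * / (f y * f x))%C).
  assert (Hq : continuous (U := C_UniformSpace) q x).
  { apply continuous_Cmult; [now apply continuous_Copp|].
    apply continuous_Cinv; [|now apply Cmult_neq_0].
    apply continuous_Cmult; auto. apply continuous_const. }
  assert (Hnz : locally x (fun y => f y <> 0%C)).
  { generalize (proj1 (continuous_C_eps f x) Hc _ (proj1 (Cmod_gt_0 _) Hx)).
    apply filter_imp. intros y Hy E. rewrite E in Hy.
    replace (0 - f x)%C with (- f x)%C in Hy by ring. rewrite Cmod_opp in Hy. lra. }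
  exists (fun y => if excluded_middle_informative (f y = 0%C)
    then ((/ f y - / f x) / (iota y - iota x))%C else q y).
  split; [|split].
  - apply (continuous_ext_loc _ q); auto.
    revert Hnz. apply filter_imp. intros y Hy.
    now destruct (excluded_middle_informative (f y = 0%C)).
  - destruct (excluded_middle_informative (f x = 0%C)); [easy|].
    unfold q. rewrite p2. reflexivity.
  - intros y. destruct (excluded_middle_informative (f y = 0%C)) as [E|E].
    + assert ((iota y - iota x)%C <> 0%C).
      { intros E'. apply Hx. rewrite <- E, (p3 y), E'. ring. }
      generalize (/ f y)%C (/ f x)%C. intros. now field.
    + unfold q. assert (E1 : ((iota y - iota x) * p y)%C = (f y - f x)%C).
      { rewrite (p3 y). ring. }
      replace ((iota y - iota x) * (- p y * / (f y * f x)))%C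
        with (- ((iota y - iota x) * p y) * / (f y * f x))%C by ring.
      rewrite E1. now field.
Qed.

End Calculus.

Lemma continuous_idC (z : C) :
  continuous (T := C_UniformSpace) (U := C_UniformSpace) (fun w => w) z.
Proof. apply continuous_id. Qed.

Lemma Cderiv_continuous f z l :
  Cderiv f z l -> continuous (T := C_UniformSpace) (U := C_UniformSpace) f z.
Proof. apply cder_continuous, continuous_idC. Qed.

Lemma Rderiv_continuous f x l :
  Rderiv f x l -> continuous (T := R_UniformSpace) (U := C_UniformSpace) f x.
Proof. apply cder_continuous, continuous_RtoC. Qed.

Lemma Cderiv_mult f g z l m :
  Cderiv f z l -> Cderiv g z m -> Cderiv (fun w => (f w * g w)%C) z (l * g z + f z * m)%C.
Proof. apply cder_mult, continuous_idC. Qed.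

Lemma Rderiv_mult f g x l m :
  Rderiv f x l -> Rderiv g x m -> Rderiv (fun y => (f y * g y)%C) x (l * g x + f x * m)%C.
Proof. apply cder_mult, continuous_RtoC. Qed.

Lemma Cderiv_comp f g z l m :
  Cderiv f (g z) l -> Cderiv g z m -> Cderiv (fun w => f (g w)) z (m * l)%C.
Proof.
  intros Hf Hg. assert (Hc := Cderiv_continuous _ _ _ Hg). revert Hf Hg.
  intros (p & p1 & p2 & p3) (q & q1 & q2 & q3).
  exists (fun w => (q w * p (g w))%C). split; [|split].
  - apply continuous_Cmult; auto.
    now apply (continuous_comp (U := C_UniformSpace) (V := C_UniformSpace) g p).
  - now rewrite p2, q2.
  - intros w. rewrite (p3 (g w)). rewrite (q3 w) at 1. ring.
Qed.

Lemma Rderiv_comp f g x l m :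
  Cderiv f (g x) l -> Rderiv g x m -> Rderiv (fun y => f (g y)) x (m * l)%C.
Proof.
  intros Hf Hg. assert (Hc := Rderiv_continuous _ _ _ Hg). revert Hf Hg.
  intros (p & p1 & p2 & p3) (q & q1 & q2 & q3).
  exists (fun w => (q w * p (g w))%C). split; [|split].
  - apply continuous_Cmult; auto.
    now apply (continuous_comp (U := R_UniformSpace) (V := C_UniformSpace) g p).
  - now rewrite p2, q2.
  - intros w. rewrite (p3 (g w)). rewrite (q3 w) at 1. ring.
Qed.

(** Analytic estimates produce derivatives in this form; the passage back is by
    the continuity of the difference quotient. *)
Lemma Cderiv_eps f z l :
  Cderiv f z l <->
  forall e, 0 < e -> exists d, 0 < d /\ forall w, Cmod (w - z) < d ->
    Cmod (f w - f z - (w - z) * l) <= e * Cmod (w - z).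
Proof.
  split.
  - intros (p & p1 & p2 & p3) e He.
    destruct (continuous_C_C p z p1 e He) as [d [Hd H]].
    exists d; split; auto. intros w Hw. rewrite (p3 w).
    replace (f z + (w - z) * p w - f z - (w - z) * l)%C
      with ((p w - l) * (w - z))%C by ring.
    rewrite Cmod_mult. apply Rmult_le_compat_r; [apply Cmod_ge_0|].
    rewrite <- p2. left. now apply H.
  - intros H.
    exists (fun w => if Ceq_dec w z then l else ((f w - f z) / (w - z))%C).
    split; [|split].
    + apply continuous_C_eps. intros e He. apply locally_C.
      destruct (H (e / 2) ltac:(lra)) as [d [Hd H1]].
      exists d; split; auto. intros w Hw. specialize (H1 w Hw).
      destruct (Ceq_dec z z) as [_|]; [|easy].
      destruct (Ceq_dec w z) as [E|E].
      * replace (l - l)%C with (RtoC 0) by ring. now rewrite Cmod_0.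
      * assert (E' : (w - z)%C <> 0%C) by now apply Cminus_eq_contra.
        assert (Hp : 0 < Cmod (w - z)) by now apply Cmod_gt_0.
        replace ((f w - f z) / (w - z) - l)%C
          with ((f w - f z - (w - z) * l) / (w - z))%C by now field.
        rewrite Cmod_div by auto.
        apply Rle_lt_trans with (e / 2); [|lra].
        apply Rmult_le_reg_r with (Cmod (w - z)); auto.
        unfold Rdiv at 1. rewrite Rmult_assoc, Rinv_l, Rmult_1_r; lra.
    + now destruct (Ceq_dec z z).
    + intros w. destruct (Ceq_dec w z) as [->|E]; [ring|].
      field. now apply Cminus_eq_contra.
Qed.

Lemma locally_AbsRing_C (z : C) (P : C -> Prop) :
  locally (T := AbsRing_UniformSpace C_AbsRing) z P <->
  exists d : R, 0 < d /\ forall w, Cmod (w - z) < d -> P w.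
Proof.
  split.
  - intros [d Hd]. exists d; split; [apply cond_pos|]. exact Hd.
  - intros [d [Hd H]]. exists (mkposreal _ Hd). exact H.
Qed.

Lemma is_derive_Cderiv (f : C -> C) (z l : C) :
  @is_derive C_AbsRing C_NormedModule f z l <-> Cderiv f z l.
Proof.
  rewrite Cderiv_eps. split.
  - intros [_ H] e He.
    specialize (H z (fun P HP => HP) (mkposreal e He)).
    apply locally_AbsRing_C in H. exact H.
  - intros H. split; [apply is_linear_scal_l|].
    intros x Hx.
    apply (is_filter_lim_locally_unique (V := AbsRing_NormedModule C_AbsRing)) in Hx. subst x.
    intros e. apply locally_AbsRing_C. exact (H e (cond_pos e)).
Qed.

Lemma entire_Cderiv (f : C -> C) : entire f <-> forall z, exists l, Cderiv f z l.
Proof.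
  split; intros H z; destruct (H z) as [l Hl]; exists l; now apply is_derive_Cderiv.
Qed.

Lemma is_derive_quotient_continuous (f : R -> R) (x l : R) :
  is_derive f x l ->
  continuous (fun y => if Req_EM_T y x then l else (f y - f x) / (y - x)) x.
Proof.
  intros H. apply is_derive_Reals in H.
  apply filterlim_locally. intros e.
  destruct (H e (cond_pos e)) as [d Hd].
  apply locally_R. exists d. split; [apply cond_pos|]. intros y Hy.
  destruct (Req_EM_T x x) as [_|]; [|easy].
  destruct (Req_EM_T y x) as [E|E]; [apply ball_center|].
  specialize (Hd (y - x) ltac:(lra) Hy).
  replace (x + (y - x)) with y in Hd by ring. exact Hd.
Qed.

Lemma Rderiv_components (f : R -> C) (x : R) (l : C) :
  Rderiv f x l <->
  is_derive (fun y => Re (f y)) x (Re l) /\ is_derive (fun y => Im (f y)) x (Im l).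
Proof.
  split.
  - assert (K : forall g phi : R -> R, forall m, continuous phi x -> phi x = m ->
      (forall y, g y = g x + (y - x) * phi y) -> is_derive g x m).
    { intros g phi m H1 H2 H3. apply is_derive_Reals. intros e He.
      destruct (proj1 (filterlim_locally _ _) H1 (mkposreal e He)) as [d Hd].
      exists d. intros h Hh Hhd. rewrite (H3 (x + h)).
      replace ((g x + (x + h - x) * phi (x + h) - g x) / h - m)
        with (phi (x + h) - phi x) by (rewrite H2; now field).
      apply (Hd (x + h)). change (Rabs (x + h - x) < d).
      now replace (x + h - x) with h by ring. }
    intros (p & p1 & p2 & p3). apply continuous_C in p1. split.
    + apply (K _ (fun y => Re (p y))); [easy|now rewrite p2|].
      intros y. unfold Re, Im. rewrite (p3 y). simpl. ring.
    + apply (K _ (fun y => Im (p y))); [easy|now rewrite p2|].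
      intros y. unfold Re, Im. rewrite (p3 y). simpl. ring.
  - intros [H1 H2].
    exists (fun y => if Req_EM_T y x then l else ((f y - f x) / RtoC (y - x))%C).
    split; [|split].
    + apply continuous_C. split.
      * eapply continuous_ext; [|exact (is_derive_quotient_continuous _ _ _ H1)].
        intros y. simpl. destruct (Req_EM_T y x); auto. simpl. unfold Re. field. lra.
      * eapply continuous_ext; [|exact (is_derive_quotient_continuous _ _ _ H2)].
        intros y. simpl. destruct (Req_EM_T y x); auto. simpl. unfold Im. field. lra.
    + now destruct (Req_EM_T x x).
    + intros y. rewrite <- RtoC_minus. destruct (Req_EM_T y x) as [->|E].
      * rewrite Rminus_diag. ring.
      * field. intros E'. apply RtoC_inj in E'. lra.
Qed.

Definition cis (t : R) : C := (cos t, sin t).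

Lemma Rderiv_cis t : Rderiv cis t (Ci * cis t)%C.
Proof.
  apply Rderiv_components. split; simpl.
  - auto_derive; auto. ring.
  - auto_derive; auto. ring.
Qed.

Lemma Cmod_cis t : Cmod (cis t) = 1.
Proof.
  unfold Cmod, cis; simpl. replace (_ + _) with 1; [apply sqrt_1|].
  generalize (sin2_cos2 t). unfold Rsqr. intros; lra.
Qed.

Lemma cis_conj t : (cis t * Cconj (cis t))%C = 1%C.
Proof.
  apply injective_projections; simpl; [|ring].
  generalize (sin2_cos2 t). unfold Rsqr. intros; lra.
Qed.

Lemma cis_0 : cis 0 = 1%C.
Proof. unfold cis. now rewrite cos_0, sin_0. Qed.

Lemma cis_2PI : cis (2 * PI) = 1%C.
Proof. unfold cis. now rewrite cos_2PI, sin_2PI. Qed.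

(** * Integrals of complex-valued functions *)

Definition CInt (f : R -> C) (a b : R) : C := RInt (V := C_R_CompleteNormedModule) f a b.

Definition cont_on (f : R -> C) (a b : R) : Prop :=
  forall t, a <= t <= b -> continuous (T := R_UniformSpace) (U := C_UniformSpace) f t.

Lemma is_RInt_CInt f a b : a <= b -> cont_on f a b ->
  is_RInt (V := C_R_NormedModule) f a b (CInt f a b).
Proof.
  intros Hab H. apply (RInt_correct (V := C_R_CompleteNormedModule)).
  apply (ex_RInt_continuous (V := C_R_CompleteNormedModule)).
  rewrite Rmin_left, Rmax_right by auto. exact H.
Qed.

Lemma CInt_unique f a b l : is_RInt (V := C_R_NormedModule) f a b l -> CInt f a b = l.
Proof. apply (is_RInt_unique (V := C_R_CompleteNormedModule)). Qed.

Lemma cont_on_sub f a b c d : cont_on f a b -> a <= c -> d <= b -> cont_on f c d.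
Proof. intros H Hc Hd t Ht. apply H. lra. Qed.

Lemma CInt_ext f g a b : a <= b -> (forall t, a <= t <= b -> f t = g t) ->
  CInt f a b = CInt g a b.
Proof.
  intros Hab H. apply (RInt_ext (V := C_R_CompleteNormedModule)).
  rewrite Rmin_left, Rmax_right by auto. intros t Ht. apply H. lra.
Qed.

Lemma CInt_Chasles f a b c : a <= b <= c -> cont_on f a c ->
  CInt f a c = (CInt f a b + CInt f b c)%C.
Proof.
  intros Hb H. apply CInt_unique.
  apply (is_RInt_Chasles (V := C_R_NormedModule)) with b;
    apply is_RInt_CInt; try lra; apply cont_on_sub with a c; auto; lra.
Qed.

Lemma CInt_plus f g a b : a <= b -> cont_on f a b -> cont_on g a b ->
  CInt (fun t => (f t + g t)%C) a b = (CInt f a b + CInt g a b)%C.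
Proof.
  intros Hab Hf Hg. apply CInt_unique.
  apply (is_RInt_plus (V := C_R_NormedModule)); now apply is_RInt_CInt.
Qed.

Lemma CInt_components f a b (l : C) :
  is_RInt (V := C_R_NormedModule) f a b l <->
  is_RInt (fun t => Re (f t)) a b (Re l) /\ is_RInt (fun t => Im (f t)) a b (Im l).
Proof.
  split.
  - intros H. split.
    + exact (is_RInt_fct_extend_fst (U := R_NormedModule) (V := R_NormedModule) _ _ _ _ H).
    + exact (is_RInt_fct_extend_snd (U := R_NormedModule) (V := R_NormedModule) _ _ _ _ H).
  - intros [H1 H2]. destruct l as [l1 l2].
    exact (is_RInt_fct_extend_pair (U := R_NormedModule) (V := R_NormedModule)
      f a b l1 l2 H1 H2).
Qed.

Lemma CInt_scal k f a b : a <= b -> cont_on f a b ->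
  CInt (fun t => (k * f t)%C) a b = (k * CInt f a b)%C.
Proof.
  intros Hab Hf. apply CInt_unique, CInt_components.
  destruct (proj1 (CInt_components _ _ _ _) (is_RInt_CInt f a b Hab Hf)) as [H1 H2].
  split; simpl.
  - apply (is_RInt_minus (V := R_NormedModule) (fun t => fst k * fst (f t)) (fun t => snd k * snd (f t)));
      now apply (is_RInt_scal (V := R_NormedModule)).
  - apply (is_RInt_plus (V := R_NormedModule) (fun t => fst k * snd (f t)) (fun t => snd k * fst (f t)));
      now apply (is_RInt_scal (V := R_NormedModule)).
Qed.

Lemma CInt_opp f a b : a <= b -> cont_on f a b ->
  CInt (fun t => (- f t)%C) a b = (- CInt f a b)%C.
Proof.
  intros Hab Hf. replace (- CInt f a b)%C with ((-(1)) * CInt f a b)%C by ring.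
  rewrite <- CInt_scal by auto. apply CInt_ext; auto. intros; ring.
Qed.

Lemma CInt_minus f g a b : a <= b -> cont_on f a b -> cont_on g a b ->
  CInt (fun t => (f t - g t)%C) a b = (CInt f a b - CInt g a b)%C.
Proof.
  intros Hab Hf Hg. unfold Cminus. rewrite <- CInt_opp by auto.
  apply CInt_plus; auto. intros t Ht. apply continuous_Copp; auto.
Qed.

Lemma CInt_conj f a b : a <= b -> cont_on f a b ->
  CInt (fun t => Cconj (f t)) a b = Cconj (CInt f a b).
Proof.
  intros Hab Hf. apply CInt_unique, CInt_components.
  destruct (proj1 (CInt_components _ _ _ _) (is_RInt_CInt f a b Hab Hf)) as [H1 H2].
  split; simpl; auto.
  now apply (is_RInt_opp (V := R_NormedModule) (fun t => snd (f t))).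
Qed.

Lemma CInt_const (k : C) a b : CInt (fun _ => k) a b = (RtoC (b - a) * k)%C.
Proof.
  apply CInt_unique, CInt_components. simpl. split.
  - replace (_ - _) with (scal (b - a) (Re k)) by (unfold scal; simpl; unfold mult, Re; simpl; ring).
    apply (is_RInt_const (V := R_NormedModule)).
  - replace (_ + _) with (scal (b - a) (Im k)) by (unfold scal; simpl; unfold mult, Im; simpl; ring).
    apply (is_RInt_const (V := R_NormedModule)).
Qed.

Lemma CInt_derive f df a b : a <= b ->
  (forall t, a <= t <= b -> Rderiv f t (df t)) -> cont_on df a b ->
  CInt df a b = (f b - f a)%C.
Proof.
  intros Hab H1 H2. apply CInt_unique, CInt_components. split.
  - apply (is_RInt_derive (fun t => Re (f t)) (fun t => Re (df t)));
      rewrite Rmin_left, Rmax_right by auto; intros t Ht.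
    + now apply Rderiv_components, H1.
    + now apply (continuous_C df t), H2.
  - apply (is_RInt_derive (fun t => Im (f t)) (fun t => Im (df t)));
      rewrite Rmin_left, Rmax_right by auto; intros t Ht.
    + now apply Rderiv_components, H1.
    + now apply (continuous_C df t), H2.
Qed.

Lemma CInt_bound f (g : R -> R) a b lg : a <= b -> cont_on f a b ->
  (forall t, a <= t <= b -> Cmod (f t) <= g t) -> is_RInt g a b lg ->
  Cmod (CInt f a b) <= lg.
Proof.
  intros Hab Hf Hg Hl. rewrite Cmod_norm.
  apply (norm_RInt_le (V := C_R_NormedModule) f g a b _ lg Hab); auto.
  - intros t Ht. specialize (Hg t Ht). rewrite Cmod_norm in Hg. exact Hg.
  - now apply is_RInt_CInt.
Qed.

Lemma CInt_bound_const f a b M : a <= b -> cont_on f a b ->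
  (forall t, a <= t <= b -> Cmod (f t) <= M) -> Cmod (CInt f a b) <= (b - a) * M.
Proof.
  intros Hab Hf HM. apply (CInt_bound f (fun _ => M)); auto.
  apply (is_RInt_const (V := R_NormedModule)).
Qed.

(** * Goursat's theorem *)

(** Cousin's lemma for cells similar to a given rectangle: a property that passes
    from four quarters to the whole, and holds for all small cells around each
    point, holds for the whole rectangle. Otherwise repeated quartering gives
    nested cells without the property that shrink to a point. *)
Lemma cell_induction (Good : R -> R -> R -> Prop) (a c l m : R) :
  0 <= l -> 0 <= m ->
  (forall x y h, 0 < h -> a <= x -> x + l * h <= a + l -> c <= y -> y + m * h <= c + m ->
    Good x y (h / 2) -> Good (x + l * (h / 2)) y (h / 2) ->
    Good x (y + m * (h / 2)) (h / 2) ->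
    Good (x + l * (h / 2)) (y + m * (h / 2)) (h / 2) -> Good x y h) ->
  (forall p q, a <= p <= a + l -> c <= q <= c + m -> exists d, 0 < d /\
    forall x y h, 0 < h < d -> a <= x -> x + l * h <= a + l -> c <= y -> y + m * h <= c + m ->
      x <= p <= x + l * h -> y <= q <= y + m * h -> Good x y h) ->
  Good a c 1.
Proof.
  intros Hl Hm Hquarter Hlocal. apply NNPP. intros Hbad.
  set (cell := fun (p : R * R) (n : nat) =>
    a <= fst p /\ fst p + l * (/ 2) ^ n <= a + l /\
    c <= snd p /\ snd p + m * (/ 2) ^ n <= c + m /\ ~ Good (fst p) (snd p) ((/ 2) ^ n)).
  assert (Hpos : forall n, 0 < (/ 2) ^ n) by (intros; apply pow_lt; lra).
  assert (Hstep : forall n p, cell p n -> exists p', cell p' (S n) /\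
    fst p <= fst p' /\ fst p' + l * (/ 2) ^ (S n) <= fst p + l * (/ 2) ^ n /\
    snd p <= snd p' /\ snd p' + m * (/ 2) ^ (S n) <= snd p + m * (/ 2) ^ n).
  { intros n [x y] (H1 & H2 & H3 & H4 & H5). simpl fst in *; simpl snd in *.
    assert (Hn := Hpos n). assert (Hn1 := Hpos (S n)).
    assert (E : (/ 2) ^ n / 2 = (/ 2) ^ S n) by (simpl; field).
    assert (El : l * (/ 2) ^ n = 2 * (l * (/ 2) ^ S n)) by (rewrite <- E; field).
    assert (Em : m * (/ 2) ^ n = 2 * (m * (/ 2) ^ S n)) by (rewrite <- E; field).
    assert (Pl : 0 <= l * (/ 2) ^ S n) by (apply Rmult_le_pos; lra).
    assert (Pm : 0 <= m * (/ 2) ^ S n) by (apply Rmult_le_pos; lra).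
    specialize (Hquarter x y _ Hn H1 H2 H3 H4). rewrite E in Hquarter.
    apply NNPP. intros Hno. apply H5. apply Hquarter; apply NNPP; intros HG; apply Hno.
    - exists (x, y). unfold cell. simpl fst; simpl snd. repeat split; auto; lra.
    - exists (x + l * (/ 2) ^ S n, y). unfold cell. simpl fst; simpl snd. repeat split; auto; lra.
    - exists (x, y + m * (/ 2) ^ S n). unfold cell. simpl fst; simpl snd. repeat split; auto; lra.
    - exists (x + l * (/ 2) ^ S n, y + m * (/ 2) ^ S n). unfold cell. simpl fst; simpl snd.
      repeat split; auto; lra. }
  assert (H0 : cell (a, c) 0%nat).
  { unfold cell; simpl. repeat split; auto; lra. }
  set (next := fun (n : nat) (p : {p | cell p n}) =>
    let s := constructive_indefinite_description _ (Hstep n (proj1_sig p) (proj2_sig p)) in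
    exist (fun p => cell p (S n)) (proj1_sig s) (proj1 (proj2_sig s))).
  set (seq := fix seq n : {p | cell p n} :=
    match n with O => exist _ (a, c) H0 | S k => next k (seq k) end).
  set (X := fun n => fst (proj1_sig (seq n))). set (Y := fun n => snd (proj1_sig (seq n))).
  assert (Hseq : forall n, X n <= X (S n) /\ X (S n) + l * (/ 2) ^ (S n) <= X n + l * (/ 2) ^ n /\
    Y n <= Y (S n) /\ Y (S n) + m * (/ 2) ^ (S n) <= Y n + m * (/ 2) ^ n).
  { intros n. unfold X, Y. simpl seq. unfold next.
    destruct (constructive_indefinite_description _ _) as [p' Hp']. exact (proj2 Hp'). }
  assert (Hcell : forall n, cell (X n, Y n) n).
  { intros n. unfold X, Y. generalize (proj2_sig (seq n)).
    now destruct (proj1_sig (seq n)). }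
  (* the increasing sequence of left ends converges, to a point of every interval *)
  assert (Hlim : forall (u : nat -> R) (k : R), 0 <= k ->
    (forall n, u n <= u (S n) /\ u (S n) + k * (/ 2) ^ (S n) <= u n + k * (/ 2) ^ n) ->
    exists p, forall n, u n <= p <= u n + k * (/ 2) ^ n).
  { intros u k Hk Hu.
    assert (Hdec : forall n j, u (n + j)%nat + k * (/ 2) ^ (n + j) <= u n + k * (/ 2) ^ n).
    { intros n j. induction j as [|j IH]; [rewrite Nat.add_0_r; lra|].
      rewrite Nat.add_succ_r. destruct (Hu (n + j)%nat). lra. }
    assert (Hinc : forall n j, u n <= u (n + j)%nat).
    { intros n j. induction j as [|j IH]; [rewrite Nat.add_0_r; lra|].
      rewrite Nat.add_succ_r. destruct (Hu (n + j)%nat). lra. }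
    assert (Hub : forall n j, u j <= u n + k * (/ 2) ^ n).
    { intros n j. assert (0 <= k * (/ 2) ^ n) by (apply Rmult_le_pos; [auto|left; auto]).
      assert (0 <= k * (/ 2) ^ j) by (apply Rmult_le_pos; [auto|left; auto]).
      destruct (Nat.le_ge_cases n j) as [Hnj|Hnj].
      - generalize (Hdec n (j - n)%nat). replace (n + (j - n))%nat with j by lia. lra.
      - generalize (Hinc j (n - j)%nat). replace (j + (n - j))%nat with n by lia. lra. }
    destruct (completeness (fun x => exists n, x = u n)) as [p [Hp1 Hp2]].
    - exists (u 0%nat + k * (/ 2) ^ 0). intros x [n ->]. apply Hub.
    - now exists (u 0%nat), 0%nat.
    - exists p. intros n. split; [apply Hp1; now exists n|].
      apply Hp2. intros x [j ->]. apply Hub. }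
  destruct (Hlim X l Hl (fun n => conj (proj1 (Hseq n)) (proj1 (proj2 (Hseq n))))) as [p Hp].
  destruct (Hlim Y m Hm (fun n => proj2 (proj2 (Hseq n)))) as [q Hq].
  destruct (Hcell 0%nat) as (A1 & A2 & A3 & A4 & _). simpl fst in *; simpl snd in *.
  assert (Hp0 := Hp 0%nat). assert (Hq0 := Hq 0%nat).
  destruct (Hlocal p q ltac:(lra) ltac:(lra)) as [d [Hd HG]].
  destruct (pow_lt_1_zero (/ 2)) with (y := d) as [N HN]; auto.
  { rewrite Rabs_pos_eq; lra. }
  specialize (HN N (le_n N)). rewrite Rabs_pos_eq in HN by (left; auto).
  destruct (Hcell N) as (B1 & B2 & B3 & B4 & B5). simpl fst in *; simpl snd in *.
  apply B5, HG; auto.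
Qed.

(** Integral of the form [P ds + Q dt] along the boundary of
    [[a, b] x [c, d]]. *)
Definition boundary (P Q : R -> R -> C) (a b c d : R) : C :=
  (CInt (fun s => P s c) a b + CInt (fun t => Q b t) c d
   - CInt (fun s => P s d) a b - CInt (fun t => Q a t) c d)%C.

(** The exact differential of the affine part of [k] at [z] integrates exactly;
    what remains of [k] is [o(zeta - z)]. *)
Lemma edge_estimate (k : C -> C) (z kz l : C) (g g' : R -> C) (u v L D e : R) :
  u <= v -> 0 <= e ->
  (forall t, u <= t <= v -> Rderiv g t (g' t)) -> cont_on g' u v ->
  cont_on (fun t => k (g t)) u v ->
  (forall t, u <= t <= v -> Cmod (g' t) <= L) ->
  (forall t, u <= t <= v -> Cmod (g t - z) <= D) ->
  (forall w, Cmod (w - z) <= D -> Cmod (k w - (kz + (w - z) * l)) <= e * Cmod (w - z)) ->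
  let Phi := fun w => (kz * w + l * ((w - z) * (w - z)) / 2)%C in
  Cmod (CInt (fun t => (k (g t) * g' t)%C) u v - (Phi (g v) - Phi (g u))) <= (v - u) * (e * D * L).
Proof.
  intros Huv He Hg Hg' Hk HL HD Hkw Phi.
  assert (Hgc : cont_on g u v).
  { intros t Ht. eapply Rderiv_continuous. now apply Hg. }
  assert (Ha : cont_on (fun t => ((kz + (g t - z) * l) * g' t)%C) u v).
  { intros t Ht. apply continuous_Cmult; [|now apply Hg'].
    apply continuous_Cplus; [apply continuous_const|].
    apply continuous_Cmult; [|apply continuous_const].
    apply continuous_Cminus; [now apply Hgc|apply continuous_const]. }
  assert (E : CInt (fun t => ((kz + (g t - z) * l) * g' t)%C) u v = (Phi (g v) - Phi (g u))%C).
  { apply CInt_derive with (f := fun t => Phi (g t)); auto.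
    intros t Ht. unfold Phi. specialize (Hg t Ht).
    assert (Hz : Rderiv (fun t => (g t - z)%C) t (g' t - 0)%C).
    { apply cder_minus; auto. apply cder_const. }
    eapply cder_eq.
    { apply cder_plus.
      - apply Rderiv_mult; [apply cder_const|exact Hg].
      - apply Rderiv_mult; [|apply cder_const].
        apply Rderiv_mult; [apply cder_const|].
        apply Rderiv_mult; exact Hz. }
    cbv beta. field. }
  rewrite <- E.
  assert (Hkg : cont_on (fun t => (k (g t) * g' t)%C) u v).
  { intros t Ht. apply continuous_Cmult; auto. }
  rewrite <- CInt_minus by auto.
  apply CInt_bound_const; auto.
  - intros t Ht. apply continuous_Cminus; auto.
  - intros t Ht.
    replace (k (g t) * g' t - (kz + (g t - z) * l) * g' t)%C
      with ((k (g t) - (kz + (g t - z) * l)) * g' t)%C by ring.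
    rewrite Cmod_mult.
    apply Rmult_le_compat; try apply Cmod_ge_0; auto.
    apply Rle_trans with (e * Cmod (g t - z)); auto.
    apply Rmult_le_compat_l; auto.
Qed.

(** Goursat's theorem for the image of a rectangle under a [C^1] map [gam]:
    the pull-back of [k(w) dw] integrates to zero along the boundary. Curvilinear
    cells give both Cauchy's formula and primitives directly, since [gam] may be
    degenerate or may sweep an annulus. *)
Theorem goursat (k : C -> C) (gam gs gt : R -> R -> C) (a b c d L : R) :
  a <= b -> c <= d ->
  (forall s t, a <= s <= b -> c <= t <= d ->
     Rderiv (fun u => gam u t) s (gs s t) /\ Rderiv (gam s) t (gt s t)) ->
  (forall t, c <= t <= d -> cont_on (fun s => gs s t) a b) ->
  (forall s, a <= s <= b -> cont_on (gt s) c d) ->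
  (forall s t, a <= s <= b -> c <= t <= d -> Cmod (gs s t) <= L /\ Cmod (gt s t) <= L) ->
  (forall s t, a <= s <= b -> c <= t <= d -> exists l, Cderiv k (gam s t) l) ->
  boundary (fun s t => (k (gam s t) * gs s t)%C) (fun s t => (k (gam s t) * gt s t)%C) a b c d
  = 0%C.
Proof.
  intros Hab Hcd Hgam Cs Ct HL Hk.
  set (P := fun s t => (k (gam s t) * gs s t)%C).
  set (Q := fun s t => (k (gam s t) * gt s t)%C).
  assert (L0 : 0 <= L).
  { apply Rle_trans with (2 := proj1 (HL a c ltac:(lra) ltac:(lra))). apply Cmod_ge_0. }
  assert (Ks : forall t, c <= t <= d -> cont_on (fun s => k (gam s t)) a b).
  { intros t Ht s Hs. destruct (Hk s t Hs Ht) as [l Hl].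
    eapply Rderiv_continuous. eapply Rderiv_comp; [exact Hl|]. now apply Hgam. }
  assert (Kt : forall s, a <= s <= b -> cont_on (fun t => k (gam s t)) c d).
  { intros s Hs t Ht. destruct (Hk s t Hs Ht) as [l Hl].
    eapply Rderiv_continuous. eapply Rderiv_comp; [exact Hl|]. now apply Hgam. }
  assert (Pc : forall t, c <= t <= d -> cont_on (fun s => P s t) a b).
  { intros t Ht s Hs. apply continuous_Cmult; [now apply Ks|now apply Cs]. }
  assert (Qc : forall s, a <= s <= b -> cont_on (fun t => Q s t) c d).
  { intros s Hs t Ht. apply continuous_Cmult; [now apply Kt|now apply Ct]. }
  assert (Lip1 : forall s1 s2 t, a <= s1 -> s1 <= s2 -> s2 <= b -> c <= t <= d ->
    Cmod (gam s2 t - gam s1 t) <= (s2 - s1) * L).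
  { intros s1 s2 t H1 H2 H3 Ht.
    rewrite <- (CInt_derive (fun s => gam s t) (fun s => gs s t) s1 s2 H2).
    - apply CInt_bound_const; auto.
      + apply cont_on_sub with a b; auto.
      + intros s Hs. apply HL; auto. lra.
    - intros s Hs. apply Hgam; auto. lra.
    - apply cont_on_sub with a b; auto. }
  assert (Lip2 : forall s t1 t2, c <= t1 -> t1 <= t2 -> t2 <= d -> a <= s <= b ->
    Cmod (gam s t2 - gam s t1) <= (t2 - t1) * L).
  { intros s t1 t2 H1 H2 H3 Hs.
    rewrite <- (CInt_derive (fun t => gam s t) (fun t => gt s t) t1 t2 H2).
    - apply CInt_bound_const; auto.
      + apply cont_on_sub with c d; auto.
      + intros t Ht. apply HL; auto. lra.
    - intros t Ht. apply Hgam; auto. lra.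
    - apply cont_on_sub with c d; auto. }
  assert (Csym : forall u v : C, Cmod (u - v) = Cmod (v - u)).
  { intros u v. rewrite <- Cmod_opp. f_equal. ring. }
  assert (Lip : forall s1 s2 t1 t2 x y lx ly,
    x <= s1 <= x + lx -> x <= s2 <= x + lx -> y <= t1 <= y + ly -> y <= t2 <= y + ly ->
    a <= x -> x + lx <= b -> c <= y -> y + ly <= d ->
    Cmod (gam s1 t1 - gam s2 t2) <= (lx + ly) * L).
  { intros s1 s2 t1 t2 x y lx ly H1 H2 H3 H4 H5 H6 H7 H8.
    replace (gam s1 t1 - gam s2 t2)%C
      with ((gam s1 t1 - gam s2 t1) + (gam s2 t1 - gam s2 t2))%C by ring.
    apply Rle_trans with (1 := Cmod_triangle _ _).
    rewrite Rmult_plus_distr_r. apply Rplus_le_compat.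
    - destruct (Rle_dec s1 s2).
      + rewrite Csym. apply Rle_trans with ((s2 - s1) * L); [apply Lip1; lra|].
        apply Rmult_le_compat_r; lra.
      + apply Rle_trans with ((s1 - s2) * L); [apply Lip1; lra|].
        apply Rmult_le_compat_r; lra.
    - destruct (Rle_dec t1 t2).
      + rewrite Csym. apply Rle_trans with ((t2 - t1) * L); [apply Lip2; lra|].
        apply Rmult_le_compat_r; lra.
      + apply Rle_trans with ((t1 - t2) * L); [apply Lip2; lra|].
        apply Rmult_le_compat_r; lra. }
  set (l := b - a). set (m := d - c).
  assert (Hl : 0 <= l) by (unfold l; lra). assert (Hm : 0 <= m) by (unfold m; lra).
  assert (Hmain : forall e, 0 < e -> Cmod (boundary P Q a b c d) <= e).
  { intros e He.
    set (Good := fun x y h => Cmod (boundary P Q x (x + l * h) y (y + m * h)) <= e * (h * h)).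
    cut (Good a c 1).
    { unfold Good. rewrite !Rmult_1_r. unfold l, m.
      replace (a + (b - a)) with b by ring. now replace (c + (d - c)) with d by ring. }
    apply (cell_induction Good a c l m Hl Hm).
    - intros x y h Hh X1 X2 Y1 Y2 G1 G2 G3 G4. unfold Good in *.
      assert (0 <= l * (h / 2)) by (apply Rmult_le_pos; lra).
      assert (0 <= m * (h / 2)) by (apply Rmult_le_pos; lra).
      assert (Elh : l * h = l * (h / 2) + l * (h / 2)) by field.
      assert (Emh : m * h = m * (h / 2) + m * (h / 2)) by field.
      unfold l in X2 at 2; unfold m in Y2 at 2.
      rewrite Elh, Emh in *. rewrite <- !Rplus_assoc in *.
      set (x1 := x + l * (h / 2)) in *. set (x2 := x1 + l * (h / 2)) in *.
      set (y1 := y + m * (h / 2)) in *. set (y2 := y1 + m * (h / 2)) in *.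
      assert (x <= x1 <= x2) by (unfold x2, x1; lra).
      assert (y <= y1 <= y2) by (unfold y2, y1; lra).
      assert (E : boundary P Q x x2 y y2 =
        (boundary P Q x x1 y y1 + boundary P Q x1 x2 y y1
         + boundary P Q x x1 y1 y2 + boundary P Q x1 x2 y1 y2)%C).
      { unfold boundary.
        rewrite (CInt_Chasles (fun s => P s y) x x1 x2) by
          (first [lra | apply cont_on_sub with a b; [apply Pc; lra | lra | lra]]).
        rewrite (CInt_Chasles (fun s => P s y2) x x1 x2) by
          (first [lra | apply cont_on_sub with a b; [apply Pc; lra | lra | lra]]).
        rewrite (CInt_Chasles (fun t => Q x t) y y1 y2) by
          (first [lra | apply cont_on_sub with c d; [apply Qc; lra | lra | lra]]).
        rewrite (CInt_Chasles (fun t => Q x2 t) y y1 y2) by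
          (first [lra | apply cont_on_sub with c d; [apply Qc; lra | lra | lra]]).
        ring. }
      rewrite E.
      apply Rle_trans with (1 := Cmod_triangle _ _).
      generalize (Cmod_triangle (boundary P Q x x1 y y1 + boundary P Q x1 x2 y y1)
        (boundary P Q x x1 y1 y2)).
      generalize (Cmod_triangle (boundary P Q x x1 y y1) (boundary P Q x1 x2 y y1)).
      nra.
    - intros p q Hp Hq. unfold l in Hp; unfold m in Hq.
      destruct (Hk p q ltac:(lra) ltac:(lra)) as [k' Hk'].
      set (K := 2 * (l + m) * ((l + m) * L) * L).
      assert (K0 : 0 <= K).
      { unfold K. repeat apply Rmult_le_pos; lra. }
      assert (He' : 0 < e / (K + 1)) by (apply Rdiv_lt_0_compat; lra).
      destruct (proj1 (Cderiv_eps _ _ _) Hk' _ He') as [dl [Hdl Hrem]].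
      assert (0 <= (l + m) * L) by (apply Rmult_le_pos; lra).
      exists (dl / ((l + m) * L + 1)). split; [apply Rdiv_lt_0_compat; lra|].
      intros x y h Hh X1 X2 Y1 Y2 Hpx Hqy. unfold Good.
      assert (0 <= l * h) by (apply Rmult_le_pos; lra).
      assert (0 <= m * h) by (apply Rmult_le_pos; lra).
      unfold l in X2 at 2; unfold m in Y2 at 2.
      set (D := (l * h + m * h) * L).
      assert (HD0 : 0 <= D) by (apply Rmult_le_pos; lra).
      assert (HD : D < dl).
      { replace D with (h * ((l + m) * L)) by (unfold D; ring).
        destruct Hh as [Hh1 Hh2]. apply Rlt_div_r in Hh2; nra. }
      set (z := gam p q) in *.
      set (Phi := fun w => (k z * w + k' * ((w - z) * (w - z)) / 2)%C).
      assert (HDz : forall s t, x <= s <= x + l * h -> y <= t <= y + m * h ->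
        Cmod (gam s t - z) <= D).
      { intros s t Hs Ht. unfold z, D. apply Lip with x y; auto; lra. }
      assert (Hrem' : forall w, Cmod (w - z) <= D ->
        Cmod (k w - (k z + (w - z) * k')) <= e / (K + 1) * Cmod (w - z)).
      { intros w Hw. replace (k w - (k z + (w - z) * k'))%C
          with (k w - k z - (w - z) * k')%C by ring. apply Hrem. lra. }
      assert (Es : forall t, y <= t <= y + m * h ->
        Cmod (CInt (fun s => P s t) x (x + l * h) - (Phi (gam (x + l * h) t) - Phi (gam x t)))
          <= (x + l * h - x) * (e / (K + 1) * D * L)).
      { intros t Ht.
        apply (edge_estimate k z (k z) k' (fun s => gam s t) (fun s => gs s t)); auto; try lra.
        - intros s Hs. apply Hgam; lra.
        - apply cont_on_sub with a b; [apply Cs| |]; lra.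
        - apply cont_on_sub with a b; [apply Ks| |]; lra.
        - intros s Hs. apply HL; lra. }
      assert (Et : forall s, x <= s <= x + l * h ->
        Cmod (CInt (fun t => Q s t) y (y + m * h) - (Phi (gam s (y + m * h)) - Phi (gam s y)))
          <= (y + m * h - y) * (e / (K + 1) * D * L)).
      { intros s Hs.
        apply (edge_estimate k z (k z) k' (fun t => gam s t) (fun t => gt s t)); auto; try lra.
        - intros t Ht. apply Hgam; lra.
        - apply cont_on_sub with c d; [apply Ct| |]; lra.
        - apply cont_on_sub with c d; [apply Kt| |]; lra.
        - intros t Ht. apply HL; lra. }
      assert (E1 := Es y ltac:(lra)). assert (E2 := Es (y + m * h) ltac:(lra)).
      assert (E3 := Et x ltac:(lra)). assert (E4 := Et (x + l * h) ltac:(lra)).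
      unfold boundary.
      revert E1 E2 E3 E4.
      generalize (CInt (fun s => P s y) x (x + l * h)) (CInt (fun s => P s (y + m * h)) x (x + l * h))
        (CInt (fun t => Q x t) y (y + m * h)) (CInt (fun t => Q (x + l * h) t) y (y + m * h))
        (Phi (gam x y)) (Phi (gam (x + l * h) y)) (Phi (gam x (y + m * h)))
        (Phi (gam (x + l * h) (y + m * h))).
      intros I1 I2 I3 I4 F1 F2 F3 F4 E1 E2 E3 E4.
      replace (I1 + I4 - I2 - I3)%C with
        (((I1 - (F2 - F1)) + (I4 - (F4 - F2))) + (- (I2 - (F4 - F3)) + - (I3 - (F3 - F1))))%C by ring.
      apply Rle_trans with (1 := Cmod_triangle _ _).
      generalize (Cmod_triangle (I1 - (F2 - F1)) (I4 - (F4 - F2))).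
      generalize (Cmod_triangle (- (I2 - (F4 - F3))) (- (I3 - (F3 - F1)))).
      rewrite !Cmod_opp. intros T1 T2.
      apply Rle_trans with (2 * (l * h + m * h) * (e / (K + 1) * D * L)); [lra|].
      replace (2 * (l * h + m * h) * (e / (K + 1) * D * L))
        with (e * (h * h) * (K / (K + 1))) by (unfold D, K; field; fold K; lra).
      rewrite <- (Rmult_1_r (e * (h * h))) at 2.
      apply Rmult_le_compat_l; [nra|]. apply Rle_div_l; lra. }
  apply Cmod_eq_0. apply Rle_antisym; [|apply Cmod_ge_0].
  apply Rnot_lt_le. intros Hlt. specialize (Hmain _ (Rlt_gt _ _ (Rlt_mult_inv_pos _ 2 Hlt ltac:(lra)))).
  lra.
Qed.

(** * Cauchy's integral formula and its consequences *)

Lemma continuous_cis (x : R) :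
  continuous (T := R_UniformSpace) (U := C_UniformSpace) cis x.
Proof. eapply Rderiv_continuous. apply Rderiv_cis. Qed.

(** Syntax-directed, because unification up to conversion unfolds the complex
    operations to pairs. *)
Ltac ccont :=
  lazymatch goal with
  | |- continuous (fun _ => ?c) _ => apply continuous_const
  | |- continuous (fun x => x) _ => apply continuous_id
  | |- continuous (fun x => RtoC x) _ => apply continuous_RtoC
  | |- continuous RtoC _ => apply continuous_RtoC
  | |- continuous cis _ => apply continuous_cis
  | |- continuous (fun x => cis x) _ => apply continuous_cis
  | |- continuous (fun x => Cplus _ _) _ => apply continuous_Cplus; ccont
  | |- continuous (fun x => Cminus _ _) _ => apply continuous_Cminus; ccont
  | |- continuous (fun x => Cmult _ _) _ => apply continuous_Cmult; ccont
  | |- continuous (fun x => Copp _) _ => apply continuous_Copp; ccont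
  | _ => try assumption
  end.

Ltac cderive :=
  lazymatch goal with
  | |- cder _ (fun _ => ?c) _ _ => apply cder_const
  | |- Rderiv (fun _ => ?c) _ _ => apply cder_const
  | |- Rderiv (fun x => RtoC x) _ _ => apply cder_id
  | |- cder _ (fun x => RtoC x) _ _ => apply cder_id
  | |- Rderiv (fun x => cis x) _ _ => apply Rderiv_cis
  | |- Rderiv cis _ _ => apply Rderiv_cis
  | |- cder _ cis _ _ => apply Rderiv_cis
  | |- Rderiv RtoC _ _ => apply cder_id
  | |- cder _ RtoC _ _ => apply cder_id
  | |- Rderiv (fun x => Cplus _ _) _ _ => apply cder_plus; cderive
  | |- Rderiv (fun x => Cminus _ _) _ _ => apply cder_minus; cderive
  | |- Rderiv (fun x => Cmult _ _) _ _ => apply Rderiv_mult; cderive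
  | |- cder _ (fun x => Cplus _ _) _ _ => apply cder_plus; cderive
  | |- cder _ (fun x => Cminus _ _) _ _ => apply cder_minus; cderive
  | |- cder _ (fun x => Cmult _ _) _ _ => apply Rderiv_mult; cderive
  | |- cder _ (fun x => cis x) _ _ => apply Rderiv_cis
  | _ => idtac
  end.

Lemma C_eq_eps (u v : C) : (forall e, 0 < e -> Cmod (u - v) <= e) -> u = v.
Proof.
  intros H. apply Ceq_minus, Cmod_eq_0, Rle_antisym; [|apply Cmod_ge_0].
  apply Rnot_lt_le. intros Hlt. specialize (H (Cmod (u - v) / 2) ltac:(lra)). lra.
Qed.

Lemma Cmod_triangle_sub (u v : C) : Cmod u - Cmod v <= Cmod (u - v).
Proof.
  generalize (Cmod_triangle (u - v) v). replace (u - v + v)%C with u by ring. lra.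
Qed.

Lemma Cmod_triangle_minus (u v : C) : Cmod (u - v) <= Cmod u + Cmod v.
Proof. generalize (Cmod_triangle u (- v)). now rewrite Cmod_opp. Qed.

Lemma Cmod_RtoC (x : R) : 0 <= x -> Cmod (RtoC x) = x.
Proof. intros Hx. rewrite Cmod_R. now apply Rabs_pos_eq. Qed.

Lemma RtoC_neq0 (x : R) : x <> 0 -> RtoC x <> RtoC 0.
Proof. intros H E. now apply RtoC_inj in E. Qed.

Lemma PI2_pos : 0 < 2 * PI.
Proof. generalize PI_RGT_0. lra. Qed.

Lemma entire_continuous F z :
  entire F -> continuous (T := C_UniformSpace) (U := C_UniformSpace) F z.
Proof.
  intros HF. destruct (proj1 (entire_Cderiv F) HF z) as [l Hl].
  eapply Cderiv_continuous; exact Hl.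
Qed.

Lemma entire_comp_continuous {U : UniformSpace} F (g : U -> C) x :
  entire F -> continuous (U := C_UniformSpace) g x ->
  continuous (U := C_UniformSpace) (fun y => F (g y)) x.
Proof.
  intros HF Hg.
  apply (continuous_comp (V := C_UniformSpace) g F); auto. now apply entire_continuous.
Qed.

Definition circ (r t : R) : C := (RtoC r * cis t)%C.

Lemma Cmod_circ r t : 0 <= r -> Cmod (circ r t) = r.
Proof.
  intros Hr. unfold circ. rewrite Cmod_mult, Cmod_cis, Cmod_RtoC; auto. ring.
Qed.

Lemma circ_continuous r t :
  continuous (T := R_UniformSpace) (U := C_UniformSpace) (circ r) t.
Proof. unfold circ. ccont. Qed.

Lemma circ_away r z t : 0 <= r -> r - Cmod z <= Cmod (circ r t - z).
Proof.
  intros Hr. generalize (Cmod_triangle_sub (circ r t) z). now rewrite Cmod_circ.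
Qed.

Lemma C_neq_of_Cmod (u : C) : 0 < Cmod u -> u <> 0%C.
Proof. apply Cmod_gt_0. Qed.

(** The homotopy [z + s (zeta - s z)] carries the circle [zeta] at [s = 1] to
    infinitesimal circles around [z]; by Goursat's theorem the integral of
    [F(w) / (w - z)] does not depend on [s], and its limit at [s = 0] is
    [2 pi F(z)]. *)
Theorem cauchy_formula (F : C -> C) (z : C) (r : R) :
  entire F -> Cmod z < r ->
  CInt (fun t => (F (circ r t) * (circ r t / (circ r t - z)))%C) 0 (2 * PI)
  = (RtoC (2 * PI) * F z)%C.
Proof.
  intros HF Hz. assert (Hz0 := Cmod_ge_0 z). assert (Hr : 0 < r) by lra.
  assert (HPI := PI2_pos).
  set (gam := fun s t => (z + RtoC s * (circ r t - RtoC s * z))%C).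
  set (gs := fun s t => (circ r t - RtoC (2 * s) * z)%C).
  set (gt := fun s t => (RtoC s * (Ci * circ r t))%C).
  set (k := fun w => (F w * / (w - z))%C).
  set (I := fun s t => (F (gam s t) * (circ r t / (circ r t - RtoC s * z)))%C).
  assert (Haway : forall s t, 0 <= s <= 1 -> r - Cmod z <= Cmod (circ r t - RtoC s * z)).
  { intros s t Hs. apply Rle_trans with (2 := circ_away r (RtoC s * z) t (Rlt_le _ _ Hr)).
    rewrite Cmod_mult, Cmod_RtoC by lra. nra. }
  assert (Hnz : forall s t, 0 <= s <= 1 -> (circ r t - RtoC s * z)%C <> 0%C).
  { intros s t Hs. apply C_neq_of_Cmod. specialize (Haway s t Hs). lra. }
  assert (Hgc : forall s t, continuous (T := R_UniformSpace) (U := C_UniformSpace) (gam s) t).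
  { intros s t. unfold gam. ccont; apply circ_continuous. }
  assert (HIc : forall s, 0 <= s <= 1 -> cont_on (I s) 0 (2 * PI)).
  { intros s Hs t Ht. unfold I.
    apply continuous_Cmult; [now apply entire_comp_continuous|].
    apply continuous_Cmult; [apply circ_continuous|].
    apply continuous_Cinv; [|now apply Hnz]. ccont; apply circ_continuous. }
  assert (Hconst : forall s, 0 < s <= 1 -> CInt (I s) 0 (2 * PI) = CInt (I 1) 0 (2 * PI)).
  { intros s0 Hs0.
    assert (HG := goursat k gam gs gt s0 1 0 (2 * PI) (3 * r)). unfold boundary in HG.
    assert (HQ : forall s t, 0 < s <= 1 -> (k (gam s t) * gt s t)%C = (Ci * I s t)%C).
    { intros s t Hs. unfold k, I, gt.
      replace (gam s t - z)%C with (RtoC s * (circ r t - RtoC s * z))%C by (unfold gam; ring).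
      field. split; [apply Hnz; lra|apply RtoC_neq0; lra]. }
    rewrite (CInt_ext (fun t => (k (gam 1 t) * gt 1 t)%C) (fun t => (Ci * I 1 t)%C)) in HG
      by (try lra; intros; apply HQ; lra).
    rewrite (CInt_ext (fun t => (k (gam s0 t) * gt s0 t)%C) (fun t => (Ci * I s0 t)%C)) in HG
      by (try lra; intros; apply HQ; lra).
    rewrite !CInt_scal in HG by (try lra; apply HIc; lra).
    assert (Hper : forall s, (k (gam s (2 * PI)%R) * gs s (2 * PI)%R)%C = (k (gam s 0) * gs s 0)%C).
    { intros s. unfold gam, gs, circ. now rewrite cis_2PI, cis_0. }
    rewrite (CInt_ext (fun s => (k (gam s (2 * PI)%R) * gs s (2 * PI)%R)%C)
      (fun s => (k (gam s 0) * gs s 0)%C)) in HG by (try lra; intros; apply Hper).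
    apply Ceq_minus. apply Ceq_minus.
    assert (HG0 : (Ci * (CInt (I 1) 0 (2 * PI) - CInt (I s0) 0 (2 * PI)))%C = 0%C).
    { rewrite <- HG; try lra; [ring| | | | |].
      - intros s t Hs Ht. split.
        + eapply cder_eq; [unfold gam; cderive|]. unfold gs. cbv beta.
          rewrite RtoC_mult. ring.
        + eapply cder_eq; [unfold gam, circ; cderive|]. unfold gt, circ. cbv beta. ring.
      - intros t Ht s Hs. unfold gs.
        apply continuous_ext with (fun s : R => (circ r t - RtoC 2 * RtoC s * z)%C).
        { intros u. now rewrite RtoC_mult. }
        ccont.
      - intros s Hs t Ht. unfold gt. ccont; apply circ_continuous.
      - intros s t Hs Ht. unfold gs, gt. split.
        + apply Rle_trans with (1 := Cmod_triangle_minus _ _).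
          rewrite Cmod_mult, Cmod_circ, Cmod_RtoC by lra. nra.
        + rewrite !Cmod_mult, Cmod_circ, Cmod_RtoC, Cmod_Ci by lra. nra.
      - intros s t Hs Ht. destruct (proj1 (entire_Cderiv F) HF (gam s t)) as [l Hl].
        eexists. unfold k. apply Cderiv_mult; [exact Hl|].
        apply (cder_inv (U := C_UniformSpace) (fun w => w) (fun w => (w - z)%C));
          [apply continuous_idC| |].
        + apply cder_minus; [apply cder_id|apply cder_const].
        + replace (gam s t - z)%C with (RtoC s * (circ r t - RtoC s * z))%C by (unfold gam; ring).
          apply Cmult_neq_0; [apply RtoC_neq0; lra|apply Hnz; lra]. }
    apply Ceq_minus. apply (f_equal (fun x => (Ci * x)%C)) in HG0.
    replace (CInt (I s0) 0 (2 * PI) - CInt (I 1) 0 (2 * PI))%C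
      with (- (Ci * Ci) * (CInt (I s0) 0 (2 * PI) - CInt (I 1) 0 (2 * PI)))%C.
    - replace (- (Ci * Ci) * (CInt (I s0) 0 (2 * PI) - CInt (I 1) 0 (2 * PI)))%C
        with (Ci * (Ci * (CInt (I 1) 0 (2 * PI) - CInt (I s0) 0 (2 * PI))))%C by ring.
      rewrite HG0. ring.
    - replace (Ci * Ci)%C with (- (1))%C; [ring|].
      apply injective_projections; simpl; ring. }
  rewrite (CInt_ext _ (I 1)); [|lra|].
  2:{ intros t Ht. unfold I, gam. replace (z + 1 * (circ r t - 1 * z))%C with (circ r t) by ring.
      now replace (1 * z)%C with z by ring. }
  apply C_eq_eps. intros e He.
  set (d0 := r - Cmod z). assert (Hd0 : 0 < d0) by (unfold d0; lra).
  (* the two parts of the integrand that vanish with [s] each get half of [e] *)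
  set (e1 := e / 2 / (2 * PI) * d0 / r).
  assert (He1 : 0 < e1).
  { unfold e1. apply Rdiv_lt_0_compat; auto. apply Rmult_lt_0_compat; auto.
    repeat apply Rdiv_lt_0_compat; lra. }
  destruct (continuous_C_C F z (entire_continuous F z HF) e1 He1) as [d [Hd HFd]].
  set (K := Cmod (F z) * Cmod z / d0).
  assert (HK : 0 <= K).
  { unfold K. apply Rmult_le_pos; [apply Rmult_le_pos; apply Cmod_ge_0|].
    left; now apply Rinv_0_lt_compat. }
  set (s := Rmin 1 (Rmin (d / (4 * r)) (e / 2 / (2 * PI) / (K + 1)))).
  assert (Hs1 : s <= 1) by apply Rmin_l.
  assert (Hs2 : s <= d / (4 * r)).
  { apply Rle_trans with (1 := Rmin_r _ _). apply Rmin_l. }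
  assert (Hs3 : s <= e / 2 / (2 * PI) / (K + 1)).
  { apply Rle_trans with (1 := Rmin_r _ _). apply Rmin_r. }
  assert (Hs0 : 0 < s).
  { repeat apply Rmin_glb_lt; try lra; repeat apply Rdiv_lt_0_compat; lra. }
  rewrite <- (Hconst s) by lra.
  replace (RtoC (2 * PI)) with (RtoC (2 * PI - 0)) by (f_equal; ring).
  rewrite <- CInt_const, <- CInt_minus; try lra;
    [|apply HIc; lra|intros t Ht; apply continuous_const].
  apply Rle_trans with ((2 * PI - 0) * (e1 * (r / d0) + s * K)).
  - apply CInt_bound_const; [lra| |].
    + intros t Ht. apply continuous_Cminus; [apply HIc; lra|apply continuous_const].
    + intros t Ht. unfold I.
      replace (F (gam s t) * (circ r t / (circ r t - RtoC s * z)) - F z)%C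
        with ((F (gam s t) - F z) * (circ r t / (circ r t - RtoC s * z))
          + RtoC s * (F z * z / (circ r t - RtoC s * z)))%C by (field; apply Hnz; lra).
      assert (Ha := Haway s t ltac:(lra)). fold d0 in Ha.
      assert (Hi : / Cmod (circ r t - RtoC s * z) <= / d0) by now apply Rinv_le_contravar.
      assert (Hi0 : 0 < / Cmod (circ r t - RtoC s * z)) by (apply Rinv_0_lt_compat; lra).
      apply Rle_trans with (1 := Cmod_triangle _ _).
      apply Rplus_le_compat.
      * rewrite Cmod_mult, Cmod_div by (apply Hnz; lra). rewrite Cmod_circ by lra.
        apply Rmult_le_compat; try apply Cmod_ge_0.
        { apply Rmult_le_pos; lra. }
        { left. apply HFd. replace (gam s t - z)%C with (RtoC s * (circ r t - RtoC s * z))%C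
            by (unfold gam; ring).
          rewrite Cmod_mult, Cmod_RtoC by lra.
          apply Rle_lt_trans with (s * (2 * r)).
          - apply Rmult_le_compat_l; [lra|]. apply Rle_trans with (1 := Cmod_triangle_minus _ _).
            rewrite Cmod_mult, Cmod_circ, Cmod_RtoC by lra. nra.
          - apply Rle_div_r in Hs2; lra. }
        { apply Rmult_le_compat_l; lra. }
      * rewrite Cmod_mult, Cmod_div by (apply Hnz; lra). rewrite Cmod_mult, Cmod_RtoC by lra.
        apply Rmult_le_compat_l; [lra|].
        apply Rmult_le_compat_l; [|lra]. apply Rmult_le_pos; apply Cmod_ge_0.
  - apply Rle_div_r in Hs3; [|lra].
    assert (E1 : e1 * (r / d0) = e / 2 / (2 * PI)) by (unfold e1; field; lra).
    rewrite E1. rewrite Rminus_0_r.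
    apply Rle_trans with (2 * PI * (e / 2 / (2 * PI) + e / 2 / (2 * PI))).
    + apply Rmult_le_compat_l; nra.
    + right. field. lra.
Qed.

Lemma Cderiv_ext_loc f g z l d : 0 < d ->
  (forall w, Cmod (w - z) < d -> f w = g w) -> Cderiv f z l -> Cderiv g z l.
Proof.
  intros Hd H Hf. apply Cderiv_eps. intros e He.
  destruct (proj1 (Cderiv_eps _ _ _) Hf e He) as [d' [Hd' H']].
  exists (Rmin d d'). split; [now apply Rmin_glb_lt|].
  intros w Hw. rewrite <- !H; [apply H'| |].
  - apply Rlt_le_trans with (1 := Hw), Rmin_r.
  - replace (z - z)%C with (RtoC 0) by ring. now rewrite Cmod_0.
  - apply Rlt_le_trans with (1 := Hw), Rmin_l.
Qed.

Lemma Cderiv_unique f z l m : Cderiv f z l -> Cderiv f z m -> l = m.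
Proof.
  intros H1 H2. apply is_derive_Cderiv in H1, H2.
  now rewrite <- (is_C_derive_unique _ _ _ H1), <- (is_C_derive_unique _ _ _ H2).
Qed.

Lemma entire_const c : entire (fun _ => c).
Proof. apply entire_Cderiv. intros z. eexists. apply cder_const. Qed.

Lemma entire_id : entire (fun z => z).
Proof. apply entire_Cderiv. intros z. eexists. apply (cder_id (U := C_UniformSpace)). Qed.

Lemma entire_plus f g : entire f -> entire g -> entire (fun z => (f z + g z)%C).
Proof.
  rewrite !entire_Cderiv. intros Hf Hg z.
  destruct (Hf z) as [l Hl], (Hg z) as [m Hm]. eexists. apply cder_plus; eassumption.
Qed.

Lemma entire_minus f g : entire f -> entire g -> entire (fun z => (f z - g z)%C).
Proof.
  rewrite !entire_Cderiv. intros Hf Hg z.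
  destruct (Hf z) as [l Hl], (Hg z) as [m Hm]. eexists. apply cder_minus; eassumption.
Qed.

Lemma entire_mult f g : entire f -> entire g -> entire (fun z => (f z * g z)%C).
Proof.
  rewrite !entire_Cderiv. intros Hf Hg z.
  destruct (Hf z) as [l Hl], (Hg z) as [m Hm]. eexists. apply Cderiv_mult; eassumption.
Qed.

Lemma entire_comp f g : entire f -> entire g -> entire (fun z => f (g z)).
Proof.
  rewrite !entire_Cderiv. intros Hf Hg z.
  destruct (Hg z) as [m Hm], (Hf (g z)) as [l Hl]. eexists. eapply Cderiv_comp; eassumption.
Qed.

Lemma entire_div f g : entire f -> entire g -> (forall z, g z <> 0%C) ->
  entire (fun z => (f z / g z)%C).
Proof.
  intros Hf Hg H0. apply entire_mult; auto.
  apply entire_Cderiv. intros z. destruct (proj1 (entire_Cderiv g) Hg z) as [m Hm].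
  eexists. apply (cder_inv (U := C_UniformSpace) (fun w => w)); eauto. apply continuous_idC.
Qed.

(** A second-order bound that is uniform in [t] survives integration. *)
Lemma Cderiv_CInt (k : C -> R -> C) (k' : R -> C) (z : C) (a b d K : R) :
  a <= b -> 0 < d -> 0 <= K ->
  (forall w, Cmod (w - z) < d -> cont_on (k w) a b) -> cont_on k' a b ->
  (forall w t, Cmod (w - z) < d -> a <= t <= b ->
     Cmod (k w t - k z t - (w - z) * k' t) <= K * (Cmod (w - z) * Cmod (w - z))) ->
  Cderiv (fun w => CInt (k w) a b) z (CInt k' a b).
Proof.
  intros Hab Hd HK Hk Hk' H. apply Cderiv_eps. intros e He.
  set (Q := (b - a) * K). assert (HQ : 0 <= Q) by (apply Rmult_le_pos; lra).
  exists (Rmin d (e / (Q + 1))). split.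
  { apply Rmin_glb_lt; auto. apply Rdiv_lt_0_compat; lra. }
  intros w Hw.
  assert (Hw1 : Cmod (w - z) < d) by (apply Rlt_le_trans with (1 := Hw), Rmin_l).
  assert (Hw2 : Cmod (w - z) < e / (Q + 1)) by (apply Rlt_le_trans with (1 := Hw), Rmin_r).
  assert (Hz : cont_on (k z) a b).
  { apply Hk. replace (z - z)%C with (RtoC 0) by ring. now rewrite Cmod_0. }
  specialize (Hk w Hw1).
  rewrite <- CInt_scal, <- !CInt_minus; auto;
    try (intros t Ht; ccont; auto; fail).
  apply Rle_trans with ((b - a) * (K * (Cmod (w - z) * Cmod (w - z)))).
  - apply CInt_bound_const; auto. intros t Ht. ccont; auto.
  - assert (Hm := Cmod_ge_0 (w - z)). apply Rlt_div_r in Hw2; [|lra].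
    replace ((b - a) * (K * (Cmod (w - z) * Cmod (w - z))))
      with (Q * Cmod (w - z) * Cmod (w - z)) by (unfold Q; ring).
    apply Rmult_le_compat_r; auto. lra.
Qed.

(** For [n = 1] the Cauchy transform of [phi]; up to a factor, increasing [n]
    differentiates in [z]. *)
Definition cauchy_kernel (phi : R -> C) (r : R) (n : nat) (z : C) : C :=
  CInt (fun t => (phi t / (circ r t - z) ^ n)%C) 0 (2 * PI).

Lemma cauchy_kernel_cont phi r n z :
  0 <= r -> Cmod z < r -> cont_on phi 0 (2 * PI) ->
  cont_on (fun t => (phi t / (circ r t - z) ^ n)%C) 0 (2 * PI).
Proof.
  intros Hr Hz Hphi t Ht. apply continuous_Cmult; [now apply Hphi|].
  apply continuous_Cinv.
  - induction n; simpl; ccont; apply circ_continuous.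
  - apply Cpow_nz, C_neq_of_Cmod. generalize (circ_away r z t Hr). lra.
Qed.

Lemma cont_on_bounded f a b : a <= b -> cont_on f a b ->
  exists B, 0 <= B /\ forall t, a <= t <= b -> Cmod (f t) <= B.
Proof.
  intros Hab Hf.
  destruct (bounded_continuity (V := C_R_NormedModule) f a b) as [B HB].
  { intros t Ht. exact (Hf t Ht). }
  assert (HB' : forall t, a <= t <= b -> Cmod (f t) <= B).
  { intros t Ht. rewrite Cmod_norm. left. now apply (HB t). }
  exists B. split; auto.
  apply Rle_trans with (Cmod (f a)); [apply Cmod_ge_0|]. apply HB'. lra.
Qed.

Lemma Cmod_inv_le (u : C) (d : R) : 0 < d -> d <= Cmod u -> Cmod (/ u) <= / d.
Proof.
  intros Hd Hu. rewrite Cmod_inv.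
  - now apply Rinv_le_contravar.
  - apply C_neq_of_Cmod. lra.
Qed.

(** The kernels of order [1] and [2] represent [F] and [F']; with
    [u = zeta - z] and [h = w - z], the remainder of [1 / u ^ n] is [h ^ 2] times a
    rational function that is bounded while [u] and [u - h] stay away from [0]. *)
Lemma Cderiv_cauchy_kernel phi r n z :
  Cmod z < r -> cont_on phi 0 (2 * PI) -> (n = 1 \/ n = 2)%nat ->
  Cderiv (cauchy_kernel phi r n) z (RtoC (INR n) * cauchy_kernel phi r (S n) z)%C.
Proof.
  intros Hz Hphi Hn. assert (Hz0 := Cmod_ge_0 z). assert (HPI := PI2_pos).
  unfold cauchy_kernel at 2.
  rewrite <- CInt_scal; [|lra|apply cauchy_kernel_cont; auto; lra].
  set (d := (r - Cmod z) / 2). assert (Hd : 0 < d) by (unfold d; lra).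
  destruct (cont_on_bounded phi 0 (2 * PI)) as [B [HB0 HB]]; [lra|auto|].
  assert (Hid : 0 < / d) by now apply Rinv_0_lt_compat.
  assert (Hw : forall w, Cmod (w - z) < d -> Cmod w < r /\ forall t, d <= Cmod (circ r t - w)).
  { intros w Hw. generalize (Cmod_triangle_sub w z). intros Hw'.
    assert (Hwr : Cmod w < r) by (unfold d in *; lra). split; auto. intros t.
    generalize (circ_away r w t). unfold d in *. lra. }
  assert (Hzz : Cmod (z - z) < d).
  { replace (z - z)%C with (RtoC 0) by ring. now rewrite Cmod_0. }
  apply Cderiv_CInt with (d := d)
    (K := B * (3 * (/ d * / d * / d) + 2 * d * (/ d * / d * / d * / d * / d)
               + 3 * (/ d * / d * / d * / d))); auto; try lra.
  - apply Rmult_le_pos; auto. repeat apply Rplus_le_le_0_compat;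
      repeat apply Rmult_le_pos; lra.
  - intros w H. apply cauchy_kernel_cont; auto; try lra. now apply Hw.
  - intros t Ht. apply continuous_Cmult; [apply continuous_const|].
    revert t Ht. apply cauchy_kernel_cont; auto; lra.
  - intros w t H Ht.
    assert (A1 := proj2 (Hw w H) t). assert (A2 := proj2 (Hw z Hzz) t).
    assert (N1 : (circ r t - w)%C <> 0%C) by (apply C_neq_of_Cmod; lra).
    assert (N2 : (circ r t - z)%C <> 0%C) by (apply C_neq_of_Cmod; lra).
    set (h := (w - z)%C) in *. set (u := (circ r t - z)%C) in *.
    assert (Eu : (circ r t - w)%C = (u - h)%C) by (unfold u, h; ring).
    rewrite Eu in *.
    assert (I1 := Cmod_inv_le _ _ Hd A1). assert (I2 := Cmod_inv_le _ _ Hd A2).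
    assert (P1 := Cmod_ge_0 (/ (u - h))). assert (P2 := Cmod_ge_0 (/ u)).
    assert (Hh := Cmod_ge_0 h). specialize (HB t Ht). assert (P3 := Cmod_ge_0 (phi t)).
    set (p := / d) in *.
    destruct Hn as [-> | ->]; simpl Cpow; simpl INR.
    + replace (phi t / ((u - h) * 1) - phi t / (u * 1) - h * (1 * (phi t / (u * (u * 1)))))%C
        with (h * h * (phi t * (/ (u - h) * / u * / u)))%C by (field; auto).
      rewrite !Cmod_mult.
      assert (Cmod (/ (u - h)) * Cmod (/ u) * Cmod (/ u) <= p * p * p).
      { repeat apply Rmult_le_compat; auto; repeat apply Rmult_le_pos; auto. }
      rewrite (Rmult_comm _ (Cmod h * Cmod h)).
      apply Rmult_le_compat_l; [now apply Rmult_le_pos|].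
      apply Rmult_le_compat; auto.
      { repeat apply Rmult_le_pos; auto. }
      assert (0 <= p * p * p) by (repeat apply Rmult_le_pos; lra).
      assert (0 <= d * (p * p * p * p * p)) by (repeat apply Rmult_le_pos; lra).
      assert (0 <= p * p * p * p) by (repeat apply Rmult_le_pos; lra).
      lra.
    + replace (phi t / ((u - h) * ((u - h) * 1)) - phi t / (u * (u * 1))
          - h * (RtoC (1 + 1) * (phi t / (u * (u * (u * 1))))))%C
        with (h * h * (phi t * (3 * (/ (u - h) * / (u - h) * / u * / u)
            - 2 * (h * (/ (u - h) * / (u - h) * / u * / u * / u)))))%C
        by (rewrite RtoC_plus; field; auto).
      rewrite (Rmult_comm _ (Cmod h * Cmod h)), !(Cmod_mult (h * h)), Cmod_mult.
      apply Rmult_le_compat_l; [now apply Rmult_le_pos|].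
      rewrite Cmod_mult. apply Rmult_le_compat; auto; try apply Cmod_ge_0.
      apply Rle_trans with (1 := Cmod_triangle_minus _ _).
      rewrite !Cmod_mult, !Cmod_RtoC by lra.
      assert (Cmod (/ (u - h)) * Cmod (/ (u - h)) * Cmod (/ u) * Cmod (/ u) <= p * p * p * p).
      { repeat apply Rmult_le_compat; auto; repeat apply Rmult_le_pos; auto. }
      assert (Cmod h * (Cmod (/ (u - h)) * Cmod (/ (u - h)) * Cmod (/ u) * Cmod (/ u) * Cmod (/ u))
        <= d * (p * p * p * p * p)).
      { repeat apply Rmult_le_compat; auto; repeat apply Rmult_le_pos; auto. lra. }
      assert (0 <= p * p * p) by (repeat apply Rmult_le_pos; lra).
      lra.
Qed.

(** The density does not involve [z], so [F] can be differentiated under the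
    integral. *)
Lemma cauchy_kernel_formula F r z : entire F -> Cmod z < r ->
  F z = cauchy_kernel (fun t => (F (circ r t) * circ r t * / RtoC (2 * PI))%C) r 1 z.
Proof.
  intros HF Hz. assert (HPI := PI2_pos). assert (Hz0 := Cmod_ge_0 z).
  unfold cauchy_kernel.
  assert (E := cauchy_formula F z r HF Hz).
  assert (Hn : RtoC (2 * PI) <> 0%C) by (apply RtoC_neq0; lra).
  apply (f_equal (fun x => (/ RtoC (2 * PI) * x)%C)) in E.
  rewrite <- CInt_scal in E; [|lra|].
  - rewrite (CInt_ext _ (fun t => (/ RtoC (2 * PI) *
      (F (circ r t) * (circ r t / (circ r t - z))))%C)).
    + rewrite E. now field.
    + lra.
    + intros t Ht. simpl.
      assert ((circ r t - z)%C <> 0%C).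
      { apply C_neq_of_Cmod. generalize (circ_away r z t). lra. }
      field. auto.
  - intros t Ht. apply continuous_Cmult.
    + apply entire_comp_continuous; auto. apply circ_continuous.
    + apply continuous_Cmult; [apply circ_continuous|]. apply continuous_Cinv.
      * ccont. apply circ_continuous.
      * apply C_neq_of_Cmod. generalize (circ_away r z t). lra.
Qed.

Lemma cauchy_density_cont F r : entire F ->
  cont_on (fun t => (F (circ r t) * circ r t * / RtoC (2 * PI))%C) 0 (2 * PI).
Proof.
  intros HF t Ht. ccont; try apply circ_continuous.
  apply entire_comp_continuous; auto. apply circ_continuous.
Qed.

Lemma entire_derivative F : entire F -> entire (C_derive F) /\ forall z, Cderiv F z (C_derive F z).
Proof.
  intros HF.
  assert (HD : forall z, Cderiv F z (C_derive F z)).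
  { intros z. destruct (proj1 (entire_Cderiv F) HF z) as [l Hl].
    rewrite (is_C_derive_unique F z l); auto. now apply is_derive_Cderiv. }
  split; auto. apply entire_Cderiv. intros z.
  set (r := Cmod z + 1).
  set (phi := fun t => (F (circ r t) * circ r t * / RtoC (2 * PI))%C).
  assert (Hphi : cont_on phi 0 (2 * PI)) by now apply cauchy_density_cont.
  exists (RtoC (INR 2) * cauchy_kernel phi r 3 z)%C.
  apply (Cderiv_ext_loc (cauchy_kernel phi r 2) _ z _ 1); [lra| |].
  - intros w Hw. assert (Hwr : Cmod w < r).
    { generalize (Cmod_triangle_sub w z). unfold r. lra. }
    apply (Cderiv_unique F w); auto.
    apply (Cderiv_ext_loc (cauchy_kernel phi r 1) _ w _ (r - Cmod w)); [lra| |].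
    + intros v Hv. symmetry. apply cauchy_kernel_formula; auto.
      generalize (Cmod_triangle_sub v w). lra.
    + eapply cder_eq; [apply Cderiv_cauchy_kernel; auto|]. simpl. ring.
  - apply Cderiv_cauchy_kernel; auto. unfold r; lra.
Qed.

(** Near the zero, Cauchy's formula writes [F(z)/z] itself as a Cauchy kernel
    integral. *)
Lemma entire_divide_at_0 F : entire F -> F 0%C = 0%C ->
  exists G, entire G /\ forall w, F w = (w * G w)%C.
Proof.
  intros HF H0.
  set (phi := fun t => (F (circ 1 t) * circ 1 t * / RtoC (2 * PI))%C).
  assert (Hphi : cont_on phi 0 (2 * PI)) by now apply cauchy_density_cont.
  set (psi := fun t => (phi t / circ 1 t)%C).
  assert (Hc0 : forall t, circ 1 t <> 0%C).
  { intros t. apply C_neq_of_Cmod. rewrite Cmod_circ; lra. }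
  assert (Hpsi : cont_on psi 0 (2 * PI)).
  { intros t Ht. apply continuous_Cmult; auto. apply continuous_Cinv; auto.
    apply circ_continuous. }
  assert (HPI := PI2_pos).
  assert (Hin : forall z, Cmod z < 1 -> F z = (z * cauchy_kernel psi 1 1 z)%C).
  { intros z Hz.
    assert (C0 : Cmod 0%C < 1) by (rewrite Cmod_0; lra).
    transitivity (F z - F 0%C)%C; [rewrite H0; ring|].
    rewrite (cauchy_kernel_formula F 1 z), (cauchy_kernel_formula F 1 0%C) by auto.
    fold phi. unfold cauchy_kernel.
    rewrite <- CInt_minus, <- CInt_scal; try lra;
      try (apply cauchy_kernel_cont; auto; lra).
    apply CInt_ext; [lra|]. intros t Ht. unfold psi. simpl.
    assert ((circ 1 t - z)%C <> 0%C).
    { apply C_neq_of_Cmod. generalize (circ_away 1 z t). lra. }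
    field. repeat split; auto. }
  exists (fun z => if Ceq_dec z 0%C then cauchy_kernel psi 1 1 z else (F z / z)%C). split.
  - apply entire_Cderiv. intros z. destruct (Ceq_dec z 0%C) as [->|Hz].
    + eexists. apply (Cderiv_ext_loc (cauchy_kernel psi 1 1) _ _ _ 1); [lra| |].
      * intros w Hw. replace (w - 0)%C with w in Hw by ring.
        destruct (Ceq_dec w 0%C) as [|Hw0]; auto.
        rewrite (Hin w Hw). now field.
      * apply Cderiv_cauchy_kernel; auto. rewrite Cmod_0; lra.
    + destruct (proj1 (entire_Cderiv F) HF z) as [l Hl].
      eexists. apply (Cderiv_ext_loc (fun w => (F w / w)%C) _ _ _ (Cmod z)).
      * now apply Cmod_gt_0.
      * intros w Hw. destruct (Ceq_dec w 0%C) as [->|]; auto.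
        replace (0 - z)%C with (- z)%C in Hw by ring. rewrite Cmod_opp in Hw. lra.
      * apply Cderiv_mult; [exact Hl|].
        apply (cder_inv (U := C_UniformSpace) (fun w => w)); auto; [apply continuous_idC|].
        apply cder_id.
  - intros w. destruct (Ceq_dec w 0%C) as [->|Hw].
    + rewrite H0. ring.
    + now field.
Qed.

Lemma entire_divide F a : entire F -> F a = 0%C ->
  exists G, entire G /\ forall w, F w = ((w - a) * G w)%C.
Proof.
  intros HF Ha.
  destruct (entire_divide_at_0 (fun w => F (w + a)%C)) as [G [HG H]].
  - apply (entire_comp F (fun w => (w + a)%C)); auto. apply entire_plus;
      [apply entire_id|apply entire_const].
  - now replace (0 + a)%C with a by ring.
  - exists (fun w => G (w - a)%C). split.
    + apply (entire_comp G (fun w => (w - a)%C)); auto. apply entire_minus;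
        [apply entire_id|apply entire_const].
    + intros w. rewrite <- H. f_equal. ring.
Qed.

(** Goursat's theorem for the cone [t (z + s w)] over a segment compares the
    integrals of [H] along the rays to its two ends. *)
Lemma entire_primitive H : entire H -> exists L, forall z, Cderiv L z (H z).
Proof.
  intros HH. exists (fun z => CInt (fun t => (H (RtoC t * z) * z)%C) 0 1). intros z.
  assert (Hray : forall v, cont_on (fun t => (H (RtoC t * v) * v)%C) 0 1).
  { intros v t Ht. apply continuous_Cmult; [|apply continuous_const].
    apply entire_comp_continuous; auto. ccont. }
  assert (Hseg : forall w, cont_on (fun s => (H (z + RtoC s * w) * w)%C) 0 1).
  { intros w t Ht. apply continuous_Cmult; [|apply continuous_const].
    apply entire_comp_continuous; auto. ccont. }
  assert (Hdiff : forall w, (CInt (fun t => (H (RtoC t * (z + w)) * (z + w))%C) 0 1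
    - CInt (fun t => (H (RtoC t * z) * z)%C) 0 1)%C
    = CInt (fun s => (H (z + RtoC s * w) * w)%C) 0 1).
  { intros w.
    assert (HG := goursat H (fun s t => (RtoC t * (z + RtoC s * w))%C)
      (fun s t => (RtoC t * w)%C) (fun s t => (z + RtoC s * w)%C) 0 1 0 1 (Cmod z + Cmod w)).
    unfold boundary in HG.
    rewrite (CInt_ext _ (fun _ => RtoC 0) 0 1) in HG by (intros; try lra; ring).
    rewrite CInt_const in HG.
    rewrite (CInt_ext (fun t => (H (RtoC t * (z + 1 * w)) * (z + 1 * w))%C)
      (fun t => (H (RtoC t * (z + w)) * (z + w))%C)) in HG
      by (intros; try lra; now replace (1 * w)%C with w by ring).
    rewrite (CInt_ext (fun t => (H (RtoC t * (z + 0 * w)) * (z + 0 * w))%C)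
      (fun t => (H (RtoC t * z) * z)%C)) in HG
      by (intros; try lra; now replace (z + 0 * w)%C with z by ring).
    rewrite (CInt_ext (fun s => (H (1 * (z + RtoC s * w)) * (1 * w))%C)
      (fun s => (H (z + RtoC s * w) * w)%C)) in HG
      by (intros; try lra; now rewrite !Cmult_1_l).
    apply Ceq_minus. rewrite <- HG; try lra; [ring| | | | |].
    - intros s t Hs Ht. split.
      + eapply cder_eq; [cderive|]. cbv beta. ring.
      + eapply cder_eq; [cderive|]. cbv beta. ring.
    - intros t Ht s Hs. ccont.
    - intros s Hs t Ht. ccont.
    - intros s t Hs Ht. assert (Hz := Cmod_ge_0 z). assert (Hw := Cmod_ge_0 w). split.
      + rewrite Cmod_mult, Cmod_RtoC by lra. nra.
      + apply Rle_trans with (1 := Cmod_triangle _ _).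
        rewrite Cmod_mult, Cmod_RtoC by lra. nra.
    - intros s t Hs Ht. apply entire_Cderiv; auto. }
  apply Cderiv_eps. intros e He.
  destruct (continuous_C_C H z (entire_continuous H z HH) e He) as [d [Hd HHd]].
  exists d. split; auto. intros w Hw. specialize (Hdiff (w - z)%C).
  rewrite (CInt_ext (fun t => (H (RtoC t * w) * w)%C)
    (fun t => (H (RtoC t * (z + (w - z))) * (z + (w - z)))%C))
    by (intros; try lra; now replace (z + (w - z))%C with w by ring).
  rewrite Hdiff.
  assert (E : ((w - z) * H z)%C = CInt (fun _ => (H z * (w - z))%C) 0 1).
  { rewrite CInt_const. replace (1 - 0) with 1 by ring. ring. }
  rewrite E, <- CInt_minus; [|lra|auto|intros t Ht; apply continuous_const].
  apply Rle_trans with ((1 - 0) * (e * Cmod (w - z))); [|lra].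
  apply CInt_bound_const; [lra| |].
  - intros t Ht. apply continuous_Cminus; [now apply Hseg|apply continuous_const].
  - intros t Ht.
    replace (H (z + RtoC t * (w - z)) * (w - z) - H z * (w - z))%C
      with ((H (z + RtoC t * (w - z)) - H z) * (w - z))%C by ring.
    rewrite Cmod_mult. apply Rmult_le_compat_r; [apply Cmod_ge_0|].
    left. apply HHd. replace (z + RtoC t * (w - z) - z)%C with (RtoC t * (w - z))%C by ring.
    rewrite Cmod_mult, Cmod_RtoC by lra. assert (Hm := Cmod_ge_0 (w - z)). nra.
Qed.

Lemma mean_value F r : entire F -> 0 < r ->
  CInt (fun t => F (circ r t)) 0 (2 * PI) = (RtoC (2 * PI) * F 0%C)%C.
Proof.
  intros HF Hr. assert (HPI := PI2_pos).
  rewrite <- (cauchy_formula F 0%C r) by (auto; rewrite Cmod_0; lra).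
  apply CInt_ext; [lra|]. intros t Ht.
  assert (circ r t <> 0%C) by (apply C_neq_of_Cmod; rewrite Cmod_circ; lra).
  field. now replace (circ r t - 0)%C with (circ r t) by ring.
Qed.

Lemma maximum_modulus F r B : entire F -> 0 < r ->
  (forall z, Cmod z = r -> Cmod (F z) <= B) -> Cmod (F 0%C) <= B.
Proof.
  intros HF Hr HB. assert (HPI := PI2_pos).
  assert (H := CInt_bound_const (fun t => F (circ r t)) 0 (2 * PI) B).
  rewrite mean_value, Cmod_mult, Cmod_RtoC in H by (auto; lra).
  apply Rmult_le_reg_l with (2 * PI); auto. rewrite Rminus_0_r in H. apply H; [lra| |].
  - intros t Ht. apply entire_comp_continuous; auto. apply circ_continuous.
  - intros t Ht. apply HB. apply Cmod_circ. lra.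
Qed.

(** * Zero-free entire functions of slow growth *)

(** The Fourier coefficients of index [1] of [E] and of [Re E] on the circle
    agree up to the factor [2], because the mean of [w E(w)] vanishes; and the
    coefficient of [Re E >= 0] is at most its mean. *)
Lemma caratheodory E l r : entire E -> Cderiv E 0%C l -> 0 < r ->
  (forall t, 0 <= Re (E (circ r t))) -> Cmod l * r <= 2 * Re (E 0%C).
Proof.
  intros HE Hl Hr Hpos. assert (HPI := PI2_pos).
  destruct (entire_divide (fun w => (E w - E 0%C)%C) 0%C) as [Q [HQ HEQ]].
  { apply entire_minus; auto. apply entire_const. }
  { ring. }
  assert (HQ0 : Q 0%C = l).
  { apply (Cderiv_unique E 0%C); auto.
    destruct (proj1 (entire_Cderiv Q) HQ 0%C) as [m Hm].
    apply (cder_ext _ (fun w => (w * Q w + E 0%C)%C)).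
    - intros w. generalize (HEQ w). intros H.
      replace (E w) with ((E w - E 0) + E 0)%C by ring. rewrite H. ring.
    - eapply cder_eq.
      + apply cder_plus; [|apply cder_const].
        apply Cderiv_mult; [apply cder_id|exact Hm].
      + cbv beta. ring. }
  assert (HEc : cont_on (fun t => E (circ r t)) 0 (2 * PI)).
  { intros t Ht. apply entire_comp_continuous; auto. apply circ_continuous. }
  assert (Hcis : cont_on cis 0 (2 * PI)).
  { intros t Ht. apply continuous_cis. }
  assert (Hconj : forall f, cont_on f 0 (2 * PI) -> cont_on (fun t => Cconj (f t)) 0 (2 * PI)).
  { intros f Hf t Ht. specialize (Hf t Ht). apply continuous_C in Hf.
    apply continuous_C. simpl. split; [apply Hf|].
    apply (continuous_opp (V := R_NormedModule) (fun y => Im (f y))). apply Hf. }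
  assert (Hrn : RtoC r <> 0%C) by (apply RtoC_neq0; lra).
  assert (Hcn : forall t, cis t <> 0%C).
  { intros t. apply C_neq_of_Cmod. rewrite Cmod_cis. lra. }
  assert (I1 : CInt (fun t => (cis t * E (circ r t))%C) 0 (2 * PI) = 0%C).
  { assert (H := mean_value (fun w => (w * E w)%C) r).
    rewrite (CInt_ext _ (fun t => (RtoC r * (cis t * E (circ r t)))%C)) in H
      by (try lra; intros; unfold circ; ring).
    rewrite CInt_scal in H; [|lra|intros t Ht; apply continuous_Cmult; auto].
    assert (H' : (RtoC r * CInt (fun t => cis t * E (circ r t)) 0 (2 * PI))%C = 0%C).
    { rewrite H; auto; [ring|]. apply entire_mult; auto. apply entire_id. }
    apply (f_equal (fun x => (/ RtoC r * x)%C)) in H'.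
    rewrite Cmult_assoc, Cinv_l, Cmult_1_l in H' by auto. rewrite H'. ring. }
  assert (I2 : CInt cis 0 (2 * PI) = 0%C).
  { assert (H := mean_value (fun w => w) r entire_id Hr). unfold circ in H.
    rewrite CInt_scal in H; [|lra|auto].
    apply (f_equal (fun x => (/ RtoC r * x)%C)) in H.
    rewrite Cmult_assoc, Cinv_l, Cmult_1_l in H by auto. rewrite H. ring. }
  assert (I3 : (RtoC (2 * PI) * (RtoC r * l))%C
    = CInt (fun t => (Cconj (cis t) * (E (circ r t) - E 0%C))%C) 0 (2 * PI)).
  { rewrite <- HQ0. replace (RtoC (2 * PI) * (RtoC r * Q 0%C))%C
      with (RtoC r * (RtoC (2 * PI) * Q 0%C))%C by ring.
    rewrite <- (mean_value Q r), <- CInt_scal; auto; try lra.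
    - apply CInt_ext; [lra|]. intros t Ht. rewrite HEQ. unfold circ.
      replace (Cconj (cis t) * ((RtoC r * cis t - 0) * Q (RtoC r * cis t)))%C
        with (RtoC r * (cis t * Cconj (cis t)) * Q (RtoC r * cis t))%C by ring.
      rewrite cis_conj. ring.
    - intros t Ht. apply entire_comp_continuous; auto. apply circ_continuous. }
  assert (I4 : (RtoC (2 * PI) * (RtoC r * l))%C
    = CInt (fun t => (Cconj (cis t) * RtoC (2 * Re (E (circ r t))))%C) 0 (2 * PI)).
  { assert (C1 : cont_on (fun t => (Cconj (cis t) * (E (circ r t) - E 0%C))%C) 0 (2 * PI)).
    { intros t Ht. apply continuous_Cmult; [now apply Hconj|].
      apply continuous_Cminus; [now apply HEc|apply continuous_const]. }
    assert (C2 : cont_on (fun t => (E 0%C * Cconj (cis t))%C) 0 (2 * PI)).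
    { intros t Ht. apply continuous_Cmult; [apply continuous_const|now apply Hconj]. }
    assert (C3 : cont_on (fun t => (cis t * E (circ r t))%C) 0 (2 * PI)).
    { intros t Ht. apply continuous_Cmult; auto. }
    rewrite I3.
    transitivity (CInt (fun t => (Cconj (cis t) * (E (circ r t) - E 0%C))%C) 0 (2 * PI)
      + CInt (fun t => (E 0%C * Cconj (cis t))%C) 0 (2 * PI)
      + CInt (fun t => Cconj (cis t * E (circ r t))%C) 0 (2 * PI))%C.
    - rewrite CInt_scal, !CInt_conj, I1, I2 by (auto; lra).
      replace (Cconj 0%C) with (RtoC 0); [ring|].
      apply injective_projections; simpl; ring.
    - rewrite <- !CInt_plus; auto; try lra.
      + apply CInt_ext; [lra|]. intros t Ht. rewrite Cmult_conj.
        replace (RtoC (2 * Re (E (circ r t)))) with (E (circ r t) + Cconj (E (circ r t)))%C; [ring|].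
        apply injective_projections; simpl; unfold Re; ring.
      + intros t Ht. apply continuous_Cplus; auto. }
  assert (HRe := proj1 (proj1 (CInt_components _ _ _ _) (is_RInt_CInt _ _ _ (Rlt_le _ _ HPI) HEc))).
  rewrite mean_value in HRe by auto.
  apply (is_RInt_scal (V := R_NormedModule) _ _ _ 2) in HRe.
  assert (B : Cmod (RtoC (2 * PI) * (RtoC r * l)) <= 2 * (2 * PI * Re (E 0%C))).
  { rewrite I4. rewrite re_scal_l in HRe. eapply CInt_bound; [lra| | |exact HRe].
    - intros t Ht. apply continuous_Cmult; [now apply Hconj|].
      apply continuous_C. simpl. split; [|apply continuous_const].
      apply (continuous_scal_r (V := R_NormedModule) 2 (fun t => Re (E (circ r t)))).
      now apply (continuous_C _ t), HEc.
    - intros t Ht. rewrite Cmod_mult, Cmod_conj, Cmod_cis, Cmod_RtoC, Rmult_1_l.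
      + apply Rle_refl.
      + specialize (Hpos t). lra. }
  rewrite !Cmod_mult, !Cmod_RtoC in B by lra.
  apply Rmult_le_reg_l with (2 * PI); auto. lra.
Qed.

Lemma Rderiv_zero_const (f : R -> R) a b : a <= b ->
  (forall t, a <= t <= b -> is_derive f t 0) -> f b = f a.
Proof.
  intros Hab H. destruct Hab as [Hab|<-]; auto.
  destruct (MVT_gen f a b (fun _ => 0)) as [c [_ Hc]].
  - rewrite Rmin_left, Rmax_right by lra. intros t Ht. apply H. lra.
  - rewrite Rmin_left, Rmax_right by lra. intros t Ht.
    apply continuity_pt_filterlim.
    apply (ex_derive_continuous (V := R_NormedModule) f t). eexists. now apply H.
  - lra.
Qed.

Lemma Cderiv_zero_const f : (forall z, Cderiv f z 0%C) -> forall z, f z = f 0%C.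
Proof.
  intros H z.
  assert (E := CInt_derive (fun t => f (RtoC t * z)%C) (fun _ => RtoC 0) 0 1).
  rewrite CInt_const in E. rewrite Cmult_1_l, Cmult_0_l in E.
  apply Ceq_minus. rewrite <- E; [ring|lra| |intros t Ht; apply continuous_const].
  intros t Ht. eapply cder_eq.
  - apply (Rderiv_comp f (fun t => (RtoC t * z)%C)); [apply H|].
    apply Rderiv_mult; [apply cder_id|apply cder_const].
  - cbv beta. ring.
Qed.

(** A primitive of [g'/g] is a logarithm of [g] up to a constant. *)
Lemma log_modulus g g' L : (forall z, Cderiv g z (g' z)) -> (forall z, g z <> 0%C) ->
  (forall z, Cderiv L z (g' z / g z)%C) ->
  forall a z, Re (L z) - Re (L a) = ln (Cmod (g z)) - ln (Cmod (g a)).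
Proof.
  intros Hg Hnz HL a z.
  set (gam := fun t => (a + RtoC t * (z - a))%C).
  assert (Hgam : forall t, Rderiv gam t (z - a)%C).
  { intros t. eapply cder_eq; [unfold gam; cderive|]. cbv beta. ring. }
  assert (HN : forall w : C, w <> 0%C -> 0 < Re w ^ 2 + Im w ^ 2).
  { intros w Hw. rewrite <- Cmod2_alt. apply pow_lt. now apply Cmod_gt_0. }
  assert (Hln : forall w : C, w <> 0%C -> ln (Cmod w) = ln (Re w ^ 2 + Im w ^ 2) / 2).
  { intros w Hw. rewrite <- Cmod2_alt. simpl. rewrite Rmult_1_r, ln_mult.
    - field.
    - now apply Cmod_gt_0.
    - now apply Cmod_gt_0. }
  set (D := fun t => ln (Re (g (gam t)) ^ 2 + Im (g (gam t)) ^ 2) / 2 - Re (L (gam t))).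
  assert (HD : D 1 = D 0).
  { apply Rderiv_zero_const; [lra|]. intros t Ht.
    destruct (proj1 (Rderiv_components _ _ _) (Rderiv_comp g gam t _ _ (Hg (gam t)) (Hgam t)))
      as [D1 D2].
    destruct (proj1 (Rderiv_components _ _ _) (Rderiv_comp L gam t _ _ (HL (gam t)) (Hgam t)))
      as [D3 _].
    specialize (HN (g (gam t)) (Hnz (gam t))).
    set (x := fun t => Re (g (gam t))) in *. set (y := fun t => Im (g (gam t))) in *.
    set (v := fun t => Re (L (gam t))) in *.
    change (is_derive (fun t => ln (x t ^ 2 + y t ^ 2) / 2 - v t) t 0).
    change (0 < x t ^ 2 + y t ^ 2) in HN.
    auto_derive.
    - repeat split; auto; eexists; eassumption.
    - change (Derive (fun u => x u) t) with (Derive x t).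
      change (Derive (fun u => y u) t) with (Derive y t).
      change (Derive (fun u => v u) t) with (Derive v t).
      rewrite (is_derive_unique x t _ D1), (is_derive_unique y t _ D2), (is_derive_unique v t _ D3).
      assert (E : ((z - a) * (g' (gam t) / g (gam t)))%C
        = ((z - a) * g' (gam t) * Cconj (g (gam t)) / RtoC (x t ^ 2 + y t ^ 2))%C).
      { assert (E2 : RtoC (x t ^ 2 + y t ^ 2) = (g (gam t) * Cconj (g (gam t)))%C).
        { unfold x, y. rewrite <- Cmod2_alt. apply Cmod2_conj. }
        rewrite E2. field. split; auto.
        intros E3. apply (Hnz (gam t)). rewrite <- (Cconj_conj (g (gam t))), E3.
        apply injective_projections; simpl; ring. }
      rewrite E. unfold Cdiv. rewrite <- RtoC_inv by lra. rewrite re_scal_r, (re_mult _ (Cconj _)).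
      rewrite re_conj, im_conj. fold (x t) (y t). field. simpl in HN. lra. }
  unfold D in HD. rewrite <- !Hln in HD by auto.
  replace (gam 1) with z in HD by (unfold gam; ring).
  replace (gam 0) with a in HD by (unfold gam; ring). lra.
Qed.

Lemma exp_monotone x y : x <= y -> exp x <= exp y.
Proof. intros [H| ->]; [left; now apply exp_increasing|apply Rle_refl]. Qed.

(** With [ln x = 2 A t] this is [t <= exp t] raised to the power [A]. *)
Lemma ln_Rpower_le_sqrt A x : 0 < A -> 1 < x ->
  Rpower (ln x) A <= Rpower (2 * A) A * sqrt x.
Proof.
  intros HA Hx.
  assert (Hl : 0 < ln x) by (rewrite <- ln_1; apply ln_increasing; lra).
  set (t := ln x / (2 * A)).
  assert (Ht : 0 < t) by (unfold t; apply Rdiv_lt_0_compat; lra).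
  assert (E : ln x = 2 * A * t) by (unfold t; field; lra).
  rewrite E at 1. rewrite <- Rpower_mult_distr by lra.
  apply Rmult_le_compat_l; [left; apply exp_pos|].
  rewrite <- Rpower_sqrt by lra. unfold Rpower.
  assert (Hlt : ln t <= t).
  { rewrite <- (ln_exp t) at 2. left. apply ln_increasing; auto.
    generalize (exp_ineq1 t). lra. }
  apply exp_monotone. rewrite E.
  apply Rle_trans with (A * t); [apply Rmult_le_compat_l; lra|]. right; field.
Qed.

(** A function of growth [exp (c log^A r)] has order zero: by Carathéodory's
    inequality on larger and larger circles the logarithmic derivative of a
    zero-free one vanishes at every point. *)
Lemma zero_free_constant g c A R0 : entire g -> (forall z, g z <> 0%C) -> 0 < A -> 0 < c ->
  (forall z, R0 <= Cmod z -> ln (Cmod (g z)) <= c * Rpower (ln (Cmod z)) A) ->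
  forall z, g z = g 0%C.
Proof.
  intros Hg Hnz HA Hc Hgr.
  destruct (entire_derivative g Hg) as [Hg' HD].
  set (H := fun z => (C_derive g z / g z)%C).
  assert (HH : entire H) by now apply entire_div.
  destruct (entire_primitive H HH) as [L HL].
  assert (HLe : entire L) by (apply entire_Cderiv; eauto).
  assert (HH0 : forall a, H a = 0%C).
  { intros a. apply Cmod_eq_0, Rle_antisym; [|apply Cmod_ge_0].
    apply Rnot_lt_le. intros Hlt. set (h := Cmod (H a)) in *.
    set (K := Rpower (2 * A) A). assert (HK : 0 < K) by apply exp_pos.
    set (C3 := Rabs (ln (Cmod (g a)))). assert (HC3 : 0 <= C3) by apply Rabs_pos.
    assert (Ha := Cmod_ge_0 a).
    (* on the circle of radius [s ^ 2] the bound is [O(s)] *)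
    assert (Hs : forall s, 1 < s -> Cmod a + Rmax R0 1 < s ->
      h * (s * s) <= 2 * (c * (K * (2 * s)) + C3)).
    { intros s Hs1 Hs2. set (r := s * s). assert (Hr : s < r) by (unfold r; nra).
      assert (HR0 := Rmax_l R0 1). assert (HR1 := Rmax_r R0 1).
      set (Bd := c * (K * (2 * s)) + C3).
      assert (Hcar := caratheodory (fun w => (RtoC Bd - (L (w + a) - L a))%C) (0 - H a - 0)%C r).
      replace (Cmod (0 - H a - 0)) with h in Hcar.
      2:{ unfold h. rewrite <- (Cmod_opp (H a)). f_equal. ring. }
      eapply Rle_trans; [apply Hcar|]; try lra.
      - apply entire_minus; [apply entire_const|]. apply entire_minus; [|apply entire_const].
        apply (entire_comp L (fun w => (w + a)%C)); auto.
        apply entire_plus; [apply entire_id|apply entire_const].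
      - eapply cder_eq.
        + apply cder_minus; [apply cder_const|]. apply cder_minus; [|apply cder_const].
          apply (Cderiv_comp L (fun w => (w + a)%C)); [apply HL|].
          apply cder_plus; [apply cder_id|apply cder_const].
        + cbv beta. replace (0 + a)%C with a by ring. ring.
      - intros t.
        assert (E := log_modulus g _ L HD Hnz HL a (circ r t + a)%C).
        assert (Hm1 : Cmod (circ r t + a) <= r + Cmod a).
        { apply Rle_trans with (1 := Cmod_triangle _ _). rewrite Cmod_circ; lra. }
        assert (Hm2 : r - Cmod a <= Cmod (circ r t + a)).
        { replace (circ r t + a)%C with (circ r t - - a)%C by ring.
          apply Rle_trans with (2 := Cmod_triangle_sub _ _). rewrite Cmod_opp, Cmod_circ; lra. }
        assert (Hx1 : 1 < Cmod (circ r t + a)) by (unfold r in *; nra).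
        assert (Hx2 : R0 <= Cmod (circ r t + a)) by (unfold r in *; nra).
        assert (G := Hgr _ Hx2).
        assert (P := ln_Rpower_le_sqrt A _ HA Hx1). fold K in P.
        assert (S : sqrt (Cmod (circ r t + a)) <= 2 * s).
        { rewrite <- (sqrt_square (2 * s)) by lra. apply sqrt_le_1_alt. unfold r in *. nra. }
        assert (Hla : - ln (Cmod (g a)) <= C3).
        { unfold C3. rewrite <- Rabs_Ropp. apply Rle_abs. }
        assert (F : c * Rpower (ln (Cmod (circ r t + a))) A <= c * (K * (2 * s))).
        { apply Rmult_le_compat_l; [lra|]. apply Rle_trans with (1 := P).
          apply Rmult_le_compat_l; lra. }
        replace (Re (RtoC Bd - (L (circ r t + a) - L a))%C)
          with (Bd - (Re (L (circ r t + a)%C) - Re (L a))) by (simpl; unfold Re; ring).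
        unfold Bd. lra.
      - right. replace (0 + a)%C with a by ring. simpl. unfold Re. ring. }
    set (T := 4 * c * K + 2 * C3).
    assert (HT : 0 <= T) by (unfold T; assert (0 <= c * K) by (apply Rmult_le_pos; lra); lra).
    assert (HR1 := Rmax_r R0 1). assert (HTh : 0 <= T / h) by (apply Rmult_le_pos; [lra|left; now apply Rinv_0_lt_compat]).
    set (s := Cmod a + Rmax R0 1 + T / h + 1).
    specialize (Hs s ltac:(unfold s; lra) ltac:(unfold s; lra)).
    assert (Hs1 : 1 < s) by (unfold s; lra).
    assert (Hhs : h * s > T).
    { assert (E : h * (T / h) = T) by (field; lra). unfold s. nra. }
    assert (C3 <= C3 * s) by nra.
    assert (T * s < h * (s * s)) by nra.
    unfold T in *. nra. }
  apply Cderiv_zero_const. intros z. eapply cder_eq; [apply HD|].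
  specialize (HH0 z). unfold H in HH0.
  replace (C_derive g z) with (C_derive g z / g z * g z)%C by (field; auto).
  rewrite HH0. ring.
Qed.

(** * Maximum modulus and growth *)

(** Cauchy's formula on a larger circle reduces the compactness of the disc to
    that of an interval. *)
Lemma entire_bounded F r : entire F -> 0 <= r ->
  exists B, forall z, Cmod z <= r -> Cmod (F z) <= B.
Proof.
  intros HF Hr. assert (HPI := PI2_pos).
  destruct (cont_on_bounded (fun t => F (circ (r + 1) t)) 0 (2 * PI)) as [B [HB0 HB]]; [lra| |].
  { intros t Ht. apply entire_comp_continuous; auto. apply circ_continuous. }
  exists (B * (r + 1)). intros z Hz.
  assert (E := cauchy_formula F z (r + 1) HF ltac:(lra)).
  assert (Hn : forall t, 1 <= Cmod (circ (r + 1) t - z)).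
  { intros t. generalize (circ_away (r + 1) z t). lra. }
  apply (f_equal Cmod) in E. rewrite Cmod_mult, Cmod_RtoC in E by lra.
  apply Rmult_le_reg_l with (2 * PI); auto. rewrite <- E.
  replace (2 * PI * (B * (r + 1))) with ((2 * PI - 0) * (B * (r + 1))) by ring.
  apply CInt_bound_const; [lra| |].
  - intros t Ht. apply continuous_Cmult.
    + apply entire_comp_continuous; auto. apply circ_continuous.
    + apply continuous_Cmult; [apply circ_continuous|]. apply continuous_Cinv.
      * ccont. apply circ_continuous.
      * apply C_neq_of_Cmod. specialize (Hn t). lra.
  - intros t Ht. rewrite Cmod_mult. apply Rmult_le_compat; try apply Cmod_ge_0; auto.
    specialize (Hn t). rewrite Cmod_div by (apply C_neq_of_Cmod; lra).
    rewrite Cmod_circ by lra. apply Rle_div_l; nra.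
Qed.

Lemma M_upper f r z : entire f -> Cmod z <= r -> Cmod (f z) <= M r f.
Proof.
  intros Hf Hz. assert (Hr : 0 <= r) by (generalize (Cmod_ge_0 z); lra).
  destruct (entire_bounded f r Hf Hr) as [B HB].
  unfold M. set (S := fun x => _).
  destruct (Lub_Rbar_correct S) as [H1 H2].
  assert (Hin : S (Cmod (f z))) by now exists z.
  assert (HBS : is_ub_Rbar S B).
  { intros x [w [Hw ->]]. simpl. now apply HB. }
  specialize (H1 _ Hin). specialize (H2 _ HBS).
  destruct (Lub_Rbar S) as [x| |]; simpl in *; tauto.
Qed.

(** The constant [c'] is [c] itself when [c] is finite, and exists also for
    [c = +oo]. *)
Lemma growth_lt f A c : Rbar_lt (growth f A) c ->
  exists (c' B : R), Rbar_le c' c /\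
    forall r, B < r -> ln (M r f) < c' * Rpower (ln r) A.
Proof.
  intros H. unfold growth, LimSup_infty in H.
  set (P := fun s : Rbar => _) in H.
  destruct (Rbar_ex_glb P) as [l Hl]. rewrite (Rbar_is_glb_unique P l Hl) in H.
  destruct Hl as [_ Hglb].
  assert (Hex : exists s, P s /\ Rbar_lt s c).
  { apply NNPP. intros Hno.
    apply (Rbar_lt_not_le _ _ H). apply Hglb. intros s Hs.
    apply Rbar_not_lt_le. intros Hlt. apply Hno. now exists s. }
  destruct Hex as [s [[B ->] Hs]].
  set (S := fun x => _) in Hs. destruct (Lub_Rbar_correct S) as [Hub _].
  assert (Hc' : exists c' : R, Rbar_le c' c /\ Rbar_lt (Lub_Rbar S) c').
  { destruct c as [c| |].
    - exists c. split; [apply Rbar_le_refl|exact Hs].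
    - destruct (Lub_Rbar S) as [x| |]; [|easy|].
      + exists (x + 1). simpl. split; [easy|lra].
      + exists 0. now simpl.
    - now destruct (Lub_Rbar S). }
  destruct Hc' as [c' [Hc1 Hc2]].
  exists c', B. split; auto. intros r Hr.
  assert (Hx : S (ln (M r f) / Rpower (ln r) A)) by now exists r.
  specialize (Hub _ Hx). assert (Hlt := Rbar_le_lt_trans _ _ _ Hub Hc2). simpl in Hlt.
  apply Rlt_div_l in Hlt; auto. apply exp_pos.
Qed.

(** * Splitting off finitely many zeros *)

Definition root_product (l : list C) (w : C) : C :=
  fold_right (fun a p => ((w - a) * p)%C) 1%C l.

Lemma root_product_app l1 l2 w :
  root_product (l1 ++ l2) w = (root_product l1 w * root_product l2 w)%C.
Proof. induction l1 as [|a l1 IH]; simpl; [ring|]. rewrite IH. ring. Qed.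

Lemma root_product_entire l : entire (root_product l).
Proof.
  induction l as [|a l IH]; simpl; [apply entire_const|].
  apply entire_mult; auto. apply entire_minus; [apply entire_id|apply entire_const].
Qed.

Lemma root_product_neq0 l w : ~ In w l -> root_product l w <> 0%C.
Proof.
  induction l as [|a l IH]; simpl; intros H; [apply C1_nz|].
  apply Cmult_neq_0; [|apply IH; tauto]. apply Cminus_eq_contra. intros ->. tauto.
Qed.

Lemma root_product_In l w : In w l -> root_product l w = 0%C.
Proof.
  induction l as [|a l IH]; simpl; [easy|]. intros [->|H]; [ring|]. rewrite IH by auto. ring.
Qed.

Lemma root_product_multiplicity l a w : root_product l w =
  ((w - a) ^ count_occ Ceq_dec l a * root_product (remove Ceq_dec a l) w)%C.
Proof.
  induction l as [|b l IH]; simpl; [ring|].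
  destruct (Ceq_dec b a) as [->|Hb].
  - destruct (Ceq_dec a a); [|easy]. rewrite IH. simpl. ring.
  - destruct (Ceq_dec a b) as [->|_]; [easy|]. rewrite IH. simpl. ring.
Qed.

(** Replacing the factor [w - a] by [r - conj(a) w / r] does not change the modulus
    on the circle of radius [r] and turns the value at [0] into [r]; then apply the
    maximum modulus principle. *)
Lemma blaschke_bound l g r B : 0 < r -> entire g ->
  (forall w, Cmod w = r -> Cmod (root_product l w * g w) <= B) ->
  r ^ length l * Cmod (g 0%C) <= B.
Proof.
  intros Hr. revert g. induction l as [|a l IH]; intros g Hg HB; simpl.
  - rewrite Rmult_1_l. apply maximum_modulus with r; auto.
    intros z Hz. specialize (HB z Hz). simpl in HB. now rewrite Cmult_1_l in HB.
  - assert (Hrn : RtoC r <> 0%C) by (apply RtoC_neq0; lra).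
    assert (H : r ^ length l * Cmod ((RtoC r - Cconj a / RtoC r * 0) * g 0) <= B).
    { apply (IH (fun w => ((RtoC r - Cconj a / RtoC r * w) * g w)%C)).
      - apply entire_mult; auto. apply entire_minus; [apply entire_const|].
        apply entire_mult; [apply entire_const|apply entire_id].
      - intros w Hw. apply Rle_trans with (2 := HB w Hw). right. simpl.
        rewrite !Cmod_mult.
        assert (E : Cmod (RtoC r - Cconj a / RtoC r * w) = Cmod (w - a)); [|rewrite E; ring].
        assert (Hww : (w * Cconj w)%C = (RtoC r * RtoC r)%C).
        { rewrite <- Cmod2_conj, Hw. simpl. rewrite Rmult_1_r. now rewrite RtoC_mult. }
        assert (E : (RtoC r * (RtoC r - Cconj a / RtoC r * w))%C = (w * Cconj (w - a))%C).
        { rewrite Cminus_conj.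
          replace (w * (Cconj w - Cconj a))%C with (w * Cconj w - Cconj a * w)%C by ring.
          rewrite Hww. now field. }
        apply (f_equal Cmod) in E. rewrite !Cmod_mult, Cmod_conj, Hw, Cmod_RtoC in E by lra.
        now apply Rmult_eq_reg_l with r; [|lra]. }
    replace (RtoC r - Cconj a / RtoC r * 0)%C with (RtoC r) in H by (now field).
    rewrite Cmod_mult, Cmod_RtoC in H by lra. lra.
Qed.

(** The normalization [f(0) = 1] turns [|g(0)|] into the inverse of the product
    of the moduli of the roots. *)
Lemma jensen f g l rho r : entire f -> f 0%C = 1%C -> entire g ->
  (forall w, f w = (root_product l w * g w)%C) -> (forall a, In a l -> Cmod a <= rho) ->
  0 <= rho -> 0 < r -> r ^ length l <= rho ^ length l * M r f.
Proof.
  intros Hf H0 Hg E Hl Hrho Hr.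
  assert (B : r ^ length l * Cmod (g 0%C) <= M r f).
  { apply blaschke_bound; auto. intros w Hw. rewrite <- E. apply M_upper; auto. lra. }
  assert (P : Cmod (root_product l 0%C) <= rho ^ length l).
  { clear E B. induction l as [|a l IH]; simpl.
    - rewrite Cmod_1. lra.
    - rewrite Cmod_mult. apply Rmult_le_compat; try apply Cmod_ge_0.
      + replace (0 - a)%C with (- a)%C by ring. rewrite Cmod_opp. apply Hl. now left.
      + apply IH. intros b Hb. apply Hl. now right. }
  assert (E0 := f_equal Cmod (E 0%C)). rewrite H0, Cmod_1, Cmod_mult in E0.
  assert (Hrl : 0 < r ^ length l) by now apply pow_lt.
  assert (G0 := Cmod_ge_0 (g 0%C)).
  apply Rle_trans with (rho ^ length l * (r ^ length l * Cmod (g 0%C))).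
  - replace (r ^ length l) with (r ^ length l * (Cmod (root_product l 0%C) * Cmod (g 0%C)))
      at 1 by (rewrite <- E0; ring).
    replace (rho ^ length l * (r ^ length l * Cmod (g 0%C)))
      with (r ^ length l * (rho ^ length l * Cmod (g 0%C))) by ring.
    apply Rmult_le_compat_l; [lra|]. now apply Rmult_le_compat_r.
  - apply Rmult_le_compat_l; auto. now apply pow_le.
Qed.

Lemma M_ge_1 f r : entire f -> f 0%C = 1%C -> 0 <= r -> 1 <= M r f.
Proof.
  intros Hf H0 Hr. rewrite <- Cmod_1, <- H0. apply M_upper; auto. now rewrite Cmod_0.
Qed.

Lemma jensen_log f g l rho r : entire f -> f 0%C = 1%C -> entire g ->
  (forall w, f w = (root_product l w * g w)%C) -> (forall a, In a l -> Cmod a <= rho) ->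
  0 < rho -> 0 < r -> INR (length l) * (ln r - ln rho) <= ln (M r f).
Proof.
  intros Hf H0 Hg E Hl Hrho Hr.
  assert (J := jensen f g l rho r Hf H0 Hg E Hl (Rlt_le _ _ Hrho) Hr).
  assert (HM := M_ge_1 f r Hf H0 (Rlt_le _ _ Hr)).
  assert (Hln : ln (r ^ length l) <= ln (rho ^ length l * M r f)).
  { destruct J as [J| ->]; [|lra]. left. apply ln_increasing; auto. now apply pow_lt. }
  rewrite ln_mult, !ln_pow in Hln by (auto; try lra; now apply pow_lt). lra.
Qed.

(** On the circle of radius [e rho], each root of modulus at most [rho]
    contributes at least [1] to Jensen's inequality. *)
Lemma jensen_count f R : entire f -> f 0%C = 1%C -> exists N : nat,
  forall g l, entire g -> (forall w, f w = (root_product l w * g w)%C) ->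
    (forall a, In a l -> Cmod a <= R) -> (length l <= N)%nat.
Proof.
  intros Hf H0. set (rho := Rabs R + 1).
  assert (Hrho : 1 <= rho) by (unfold rho; generalize (Rabs_pos R); lra).
  destruct (INR_unbounded (ln (M (exp 1 * rho) f))) as [N HN]. exists N.
  intros g l Hg E Hl.
  assert (J : INR (length l) * (ln (exp 1 * rho) - ln rho) <= ln (M (exp 1 * rho) f)).
  { apply jensen_log with g; auto; try lra.
    - intros a Ha. specialize (Hl a Ha). unfold rho. generalize (Rle_abs R). lra.
    - apply Rmult_lt_0_compat; [apply exp_pos|lra]. }
  rewrite ln_mult, ln_exp in J by (try apply exp_pos; lra).
  apply INR_le. lra.
Qed.

Lemma continuous_zero_off (f : C -> C) (a : C) :
  continuous (T := C_UniformSpace) (U := C_UniformSpace) f a ->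
  (forall w, w <> a -> f w = 0%C) -> f a = 0%C.
Proof.
  intros Hf H. apply C_eq_eps. intros e He.
  destruct (continuous_C_C f a Hf e He) as [d [Hd HC]].
  assert (Hw : (a + RtoC (d / 2))%C <> a).
  { intros E. apply (f_equal (fun x => (x - a)%C)) in E.
    replace (a + RtoC (d / 2) - a)%C with (RtoC (d / 2)) in E by ring.
    replace (a - a)%C with (RtoC 0) in E by ring. apply RtoC_inj in E. lra. }
  specialize (HC (a + RtoC (d / 2))%C).
  replace (a + RtoC (d / 2) - a)%C with (RtoC (d / 2)) in HC by ring.
  rewrite Cmod_RtoC, H in HC by (auto; lra). specialize (HC ltac:(lra)).
  rewrite <- Cmod_opp. left. now replace (- (f a - 0))%C with (0 - f a)%C by ring.
Qed.

(** Comparing two factorizations at [a]: after cancelling the smaller power the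
    larger one forces a further zero. *)
Lemma order_le k m H G a : entire H -> entire G ->
  (forall w, ((w - a) ^ k * H w = (w - a) ^ m * G w)%C) -> H a <> 0%C -> (m <= k)%nat.
Proof.
  intros HH HG E Ha. apply Nat.nlt_ge. intros Hlt. apply Ha.
  set (D := fun w => (H w - (w - a) * ((w - a) ^ (m - k - 1) * G w))%C).
  assert (HD : D a = 0%C).
  { apply continuous_zero_off.
    - assert (P : forall n, entire (fun w => ((w - a) ^ n)%C)).
      { induction n; simpl; [apply entire_const|]. apply entire_mult; auto.
        apply entire_minus; [apply entire_id|apply entire_const]. }
      apply entire_continuous. apply entire_minus; auto.
      apply entire_mult; [apply entire_minus; [apply entire_id|apply entire_const]|].
      now apply entire_mult.
    - intros w Hw. assert (Hn : (w - a)%C <> 0%C) by now apply Cminus_eq_contra.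
      specialize (E w). replace m with (k + S (m - k - 1))%nat in E by lia.
      rewrite Cpow_add_r, Cpow_S in E. unfold D.
      assert (Hk := Cpow_nz _ k Hn).
      apply (f_equal (fun x => (/ (w - a) ^ k * x)%C)) in E.
      apply Ceq_minus.
      replace (H w - (w - a) * ((w - a) ^ (m - k - 1) * G w) - 0)%C
        with (/ (w - a) ^ k * ((w - a) ^ k * H w)
          - / (w - a) ^ k * ((w - a) ^ k * ((w - a) * (w - a) ^ (m - k - 1)) * G w))%C
        by (now field).
      rewrite E. ring. }
  unfold D in HD. replace (a - a)%C with (RtoC 0) in HD by ring.
  rewrite Cmult_0_l in HD. now replace (H a - 0)%C with (H a) in HD by ring.
Qed.

(** The orders at the single points suffice: a root of the list that did not
    divide the current cofactor would have its order exhausted too early. *)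
Lemma divide_by_roots f l : entire f ->
  (forall z, exists m, zero_order f z m /\ (count_occ Ceq_dec l z <= m)%nat) ->
  exists g, entire g /\ forall w, f w = (root_product l w * g w)%C.
Proof.
  intros Hf. induction l as [|a l IH]; intros Hm.
  - exists f. split; auto. intros w. simpl. ring.
  - destruct IH as [g [Hg E]].
    { intros z. destruct (Hm z) as [m [Hz Hc]]. exists m. split; auto.
      simpl in Hc. destruct (Ceq_dec a z); lia. }
    assert (Ha : g a = 0%C).
    { destruct (Hm a) as [m [[G [HG [_ EG]]] Hc]]. simpl in Hc.
      destruct (Ceq_dec a a) as [_|]; [|easy].
      apply NNPP. intros Hga.
      assert (Hle : (m <= count_occ Ceq_dec l a)%nat); [|lia].
      apply (order_le _ _ (fun w => (root_product (remove Ceq_dec a l) w * g w)%C) G a); auto.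
      - apply entire_mult; auto. apply root_product_entire.
      - intros w. rewrite <- EG, E, (root_product_multiplicity l a w). ring.
      - apply Cmult_neq_0; auto. apply root_product_neq0, remove_In. }
    destruct (entire_divide g a Hg Ha) as [h [Hh Eh]].
    exists h. split; auto. intros w. rewrite E, Eh. simpl. ring.
Qed.

Lemma sum_Sn_C (u : nat -> C) n : sum_n u (S n) = (sum_n u n + u (S n))%C.
Proof. exact (sum_Sn u n). Qed.

Lemma polynomial_mult_root f b : is_polynomial f -> is_polynomial (fun w => ((w - b) * f w)%C).
Proof.
  intros [d [a Ha]].
  assert (H : exists a' : nat -> C, forall w,
    ((w - b) * sum_n (fun k => (a k * w ^ k)%C) d)%C = sum_n (fun k => (a' k * w ^ k)%C) (S d)).
  { clear f Ha. induction d as [|d [a' IH]].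
    - exists (fun k => match k with O => (- b * a O)%C | _ => a O end).
      intros w. rewrite sum_Sn_C, !sum_O. simpl. ring.
    - exists (fun k => if Nat.eq_dec k (S (S d)) then a (S d)
        else if Nat.eq_dec k (S d) then (a' (S d) - b * a (S d))%C else a' k).
      intros w. rewrite !sum_Sn_C. specialize (IH w). rewrite sum_Sn_C in IH.
      rewrite (sum_n_ext_loc (fun k => ((if Nat.eq_dec k (S (S d)) then a (S d)
        else if Nat.eq_dec k (S d) then (a' (S d) - b * a (S d))%C else a' k) * w ^ k)%C)
        (fun k => (a' k * w ^ k)%C) d).
      + destruct (Nat.eq_dec (S (S d)) (S (S d))) as [_|]; [|easy].
        destruct (Nat.eq_dec (S d) (S (S d))) as [|_]; [lia|].
        destruct (Nat.eq_dec (S d) (S d)) as [_|]; [|easy].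
        transitivity ((w - b) * sum_n (fun k => (a k * w ^ k)%C) d
          + (w - b) * (a (S d) * w ^ S d))%C; [ring|].
        rewrite IH. simpl. ring.
      + intros k Hk. destruct (Nat.eq_dec k (S (S d))); [lia|].
        destruct (Nat.eq_dec k (S d)); [lia|easy]. }
  destruct H as [a' H]. exists (S d), a'. intros w. now rewrite Ha, H.
Qed.

Lemma polynomial_root_product l c : is_polynomial (fun w => (root_product l w * c)%C).
Proof.
  induction l as [|a l [d [b H]]].
  - exists 0%nat, (fun _ => c). intros w. rewrite sum_O. simpl. ring.
  - destruct (polynomial_mult_root (fun w => (root_product l w * c)%C) a) as [d' [b' H']].
    { now exists d, b. }
    exists d', b'. intros w. rewrite <- H'. simpl. ring.
Qed.

(** Far from the roots [root_product] has modulus at least [1], so a cofactor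
    inherits the growth of [f]. *)
Lemma cofactor_has_zero f A g l : entire f -> f 0%C = 1%C -> 0 < A ->
  Rbar_lt (growth f A) p_infty -> ~ is_polynomial f -> entire g ->
  (forall w, f w = (root_product l w * g w)%C) -> exists z, g z = 0%C.
Proof.
  intros Hf H0 HA Hgr Hp Hg E. apply NNPP. intros Hno. apply Hp.
  assert (Hnz : forall z, g z <> 0%C) by (intros z Hz; apply Hno; now exists z).
  destruct (growth_lt f A p_infty Hgr) as [c [B [_ HB]]].
  assert (HR : exists R, forall w, R <= Cmod w -> 1 <= Cmod (root_product l w)).
  { clear. induction l as [|a l [R HR]].
    - exists 0. intros w _. simpl. rewrite Cmod_1. lra.
    - exists (Rmax R (Cmod a + 1)). intros w Hw. simpl. rewrite Cmod_mult.
      assert (H1 := Rle_trans _ _ _ (Rmax_l _ _) Hw). assert (H2 := Rle_trans _ _ _ (Rmax_r _ _) Hw).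
      specialize (HR w H1). generalize (Cmod_triangle_sub w a). intros. nra. }
  destruct HR as [R HR].
  assert (Hconst : forall z, g z = g 0%C).
  { apply (zero_free_constant g (Rabs c + 1) A (Rmax R (B + 1))); auto.
    - generalize (Rabs_pos c). lra.
    - intros z Hz. assert (H1 := Rle_trans _ _ _ (Rmax_l _ _) Hz).
      assert (H2 := Rle_trans _ _ _ (Rmax_r _ _) Hz).
      specialize (HR z H1). specialize (HB (Cmod z) ltac:(lra)).
      assert (Hgz : 0 < Cmod (g z)) by now apply Cmod_gt_0.
      assert (HM : Cmod (g z) <= M (Cmod z) f).
      { apply Rle_trans with (Cmod (f z)); [|apply M_upper; auto; lra].
        rewrite E, Cmod_mult. nra. }
      assert (Hl : ln (Cmod (g z)) <= ln (M (Cmod z) f)).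
      { destruct HM as [HM| ->]; [left; now apply ln_increasing|lra]. }
      assert (HP : 0 < Rpower (ln (Cmod z)) A) by apply exp_pos.
      generalize (Rle_abs c). nra. }
  destruct (polynomial_root_product l (g 0%C)) as [d [a Ha]].
  exists d, a. intros w. now rewrite E, Hconst, Ha.
Qed.

(** If every zero of [g] had a successor of smaller modulus, infinitely many
    distinct zeros would lie in one disc. *)
Lemma minimal_zero f g l0 : entire f -> f 0%C = 1%C -> entire g ->
  (forall w, f w = (root_product l0 w * g w)%C) -> (exists z, g z = 0%C) ->
  exists z, g z = 0%C /\ forall z', g z' = 0%C -> Cmod z <= Cmod z'.
Proof.
  intros Hf H0 Hg E [z0 Hz0]. apply NNPP. intros Hno.
  assert (Hdesc : forall z, g z = 0%C -> exists z', g z' = 0%C /\ Cmod z' < Cmod z).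
  { intros z Hz. apply NNPP. intros H. apply Hno. exists z. split; auto.
    intros z' Hz'. apply Rnot_lt_le. intros Hlt. apply H. now exists z'. }
  assert (Hk : forall k, exists l h, length l = k /\ entire h /\
    (forall w, g w = (root_product l w * h w)%C) /\ (forall a, In a l -> Cmod a <= Cmod z0) /\
    exists z, g z = 0%C /\ Cmod z <= Cmod z0 /\ forall a, In a l -> Cmod z < Cmod a).
  { induction k as [|k (l & h & Hl & Hh & Eh & Hle & z & Hz & Hzz & Hlt)].
    - exists nil, g. repeat split; auto.
      + intros w. simpl. ring.
      + intros a [].
      + exists z0. repeat split; auto; [lra|]. intros a [].
    - assert (Hhz : h z = 0%C).
      { apply NNPP. intros Hn. rewrite Eh in Hz. revert Hz.
        apply Cmult_neq_0; auto. apply root_product_neq0. intros Hin.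
        specialize (Hlt z Hin). lra. }
      destruct (entire_divide h z Hh Hhz) as [h' [Hh' Eh']].
      destruct (Hdesc z Hz) as [z' [Hz' Hz'z]].
      exists (z :: l), h'. split; [simpl; now rewrite Hl|]. repeat split; auto.
      + intros w. rewrite Eh, Eh'. simpl. ring.
      + intros a [<-|Ha]; auto.
      + exists z'. repeat split; auto; [lra|].
        intros a [<-|Ha]; auto. specialize (Hlt a Ha). lra. }
  destruct (jensen_count f (Cmod z0) Hf H0) as [N HN].
  destruct (Hk (S N)) as (l & h & Hl & Hh & Eh & Hle & _).
  specialize (HN (fun w => (root_product l0 w * h w)%C) l).
  assert (length l <= N)%nat; [|lia]. apply HN; auto.
  - apply entire_mult; auto. apply root_product_entire.
  - intros w. rewrite E, Eh. ring.
Qed.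

(** * Listing the zeros *)

Definition hits (rho : nat -> C) (z : C) (i : nat) : bool :=
  if Ceq_dec (rho i) z then true else false.

Lemma count_occ_map (rho : nat -> C) z s :
  count_occ Ceq_dec (map rho s) z = length (filter (hits rho z) s).
Proof.
  induction s as [|i s IH]; simpl; auto. unfold hits at 1.
  destruct (Ceq_dec (rho i) z); simpl; now rewrite IH.
Qed.

Lemma in_filter_hits rho z s i : In i (filter (hits rho z) s) <-> In i s /\ rho i = z.
Proof.
  rewrite filter_In. unfold hits. destruct (Ceq_dec (rho i) z); intuition congruence.
Qed.

Lemma listing_factorization f K rho n : entire f -> zeros_listing f K rho ->
  listed K n -> exists g, entire g /\ forall w, f w = (root_product (map rho (seq 1 n)) w * g w)%C.
Proof.
  intros Hf [_ Hz] Hn. apply divide_by_roots; auto. intros z.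
  destruct (Hz z) as [l [Hnd [Hin Hord]]]. exists (length l). split; auto.
  rewrite count_occ_map. apply NoDup_incl_length.
  - apply NoDup_filter, seq_NoDup.
  - intros i Hi. apply in_filter_hits in Hi. destruct Hi as [Hi Ei]. apply in_seq in Hi.
    apply Hin. split; auto. destruct Hn as [Hn1 Hn2]. split; [lia|]. destruct K; auto. lia.
Qed.

(** Split off a zero of least modulus, again and again: minimality orders the
    list, and since only finitely many zeros lie in a disc, every zero is reached
    and exhausted. *)
Lemma listing_exists f : entire f -> f 0%C = 1%C ->
  (forall g l, entire g -> (forall w, f w = (root_product l w * g w)%C) -> exists z, g z = 0%C) ->
  exists rho, zeros_listing f None rho /\
    forall n, (1 <= n)%nat -> 0 < Cmod (rho n) /\ Cmod (rho n) <= Cmod (rho (S n)).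
Proof.
  intros Hf H0 Hzero.
  set (T := {g : C -> C | entire g /\ exists l, forall w, f w = (root_product l w * g w)%C}).
  assert (Hstep : forall g : T, exists p : C * T,
    proj1_sig g (fst p) = 0%C /\
    (forall z', proj1_sig g z' = 0%C -> Cmod (fst p) <= Cmod z') /\
    forall w, proj1_sig g w = ((w - fst p) * proj1_sig (snd p) w)%C).
  { intros [g [Hg [l E]]]. simpl.
    destruct (minimal_zero f g l Hf H0 Hg E (Hzero g l Hg E)) as [z [Hz Hmin]].
    destruct (entire_divide g z Hg Hz) as [h [Hh Eh]].
    assert (HT : entire h /\ exists l, forall w, f w = (root_product l w * h w)%C).
    { split; auto. exists (z :: l). intros w. rewrite E, Eh. simpl. ring. }
    exists (z, exist _ h HT). simpl. auto. }
  set (step := fun g => proj1_sig (constructive_indefinite_description _ (Hstep g))).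
  assert (Hf0 : entire f /\ exists l, forall w, f w = (root_product l w * f w)%C).
  { split; auto. exists nil. intros w. simpl. ring. }
  set (G := fix G (n : nat) : T :=
    match n with O => exist _ f Hf0 | S k => snd (step (G k)) end).
  set (rho := fun n => fst (step (G (pred n)))).
  set (h := fun n => proj1_sig (G n)).
  assert (HG : forall n, h n (rho (S n)) = 0%C /\
    (forall z', h n z' = 0%C -> Cmod (rho (S n)) <= Cmod z') /\
    forall w, h n w = ((w - rho (S n)) * h (S n) w)%C).
  { intros n. unfold h, rho. simpl. unfold step.
    destruct (constructive_indefinite_description _ (Hstep (G n))) as [p Hp]. exact Hp. }
  assert (Hh : forall n, entire (h n)).
  { intros n. unfold h. now destruct (G n) as [g [Hg Hl]]. }
  assert (Hprod : forall n w, f w = (root_product (map rho (seq 1 n)) w * h n w)%C).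
  { intros n w. induction n as [|n IH].
    - simpl. unfold h. simpl. ring.
    - rewrite seq_S, map_app, root_product_app, IH.
      destruct (HG n) as [_ [_ E]]. rewrite E. simpl. ring. }
  assert (Hmon1 : forall n, Cmod (rho (S n)) <= Cmod (rho (S (S n)))).
  { intros n. destruct (HG n) as [_ [Hmin E]]. apply Hmin. rewrite E.
    destruct (HG (S n)) as [Hz _]. rewrite Hz. ring. }
  assert (Hmon : forall m n, (1 <= m)%nat -> (m <= n)%nat -> Cmod (rho m) <= Cmod (rho n)).
  { intros m n Hm Hmn. induction Hmn as [|n Hmn IH]; [lra|].
    destruct n as [|n]; [lia|]. apply Rle_trans with (1 := IH). apply Hmon1. }
  exists rho. split; [split|].
  - intros m n [Hm _] _ Hmn. now apply Hmon.
  - intros z. destruct (jensen_count f (Cmod z) Hf H0) as [N HN].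
    assert (Hfar : forall n, (N < n)%nat -> Cmod z < Cmod (rho n)).
    { intros n Hn. apply Rnot_le_lt. intros Hle.
      specialize (HN (h n) (map rho (seq 1 n)) (Hh n) (Hprod n)).
      rewrite length_map, length_seq in HN.
      assert (n <= N)%nat; [|lia]. apply HN. intros a Ha.
      apply in_map_iff in Ha. destruct Ha as [i [<- Hi]]. apply in_seq in Hi.
      apply Rle_trans with (2 := Hle). apply Hmon; lia. }
    exists (filter (hits rho z) (seq 1 N)). split; [|split].
    + apply NoDup_filter, seq_NoDup.
    + intros n. rewrite in_filter_hits, in_seq. unfold listed. split.
      * intros [Hn En]. repeat split; auto; lia.
      * intros [[Hn _] En]. split; auto. split; [lia|].
        apply Nat.nle_gt. intros Hlt. specialize (Hfar n ltac:(lia)). rewrite En in Hfar. lra.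
    + rewrite <- count_occ_map.
      exists (fun w => (root_product (remove Ceq_dec z (map rho (seq 1 N))) w * h N w)%C).
      split; [|split].
      * apply entire_mult; auto. apply root_product_entire.
      * apply Cmult_neq_0; [apply root_product_neq0, remove_In|].
        intros Hz. destruct (HG N) as [_ [Hmin _]]. specialize (Hmin z Hz).
        specialize (Hfar (S N) ltac:(lia)). lra.
      * intros w. rewrite (Hprod N w), (root_product_multiplicity _ z w). ring.
  - intros n Hn. destruct n as [|n]; [lia|]. split; auto.
    apply Cmod_gt_0. intros E.
    assert (E0 := Hprod n 0%C). destruct (HG n) as [Hz _]. rewrite E in Hz.
    rewrite Hz, H0, Cmult_0_r in E0. now apply C1_nz.
Qed.

(** * Lower bounds for the zeros *)

(** Jensen's inequality at the [n]-th listed zero, in logarithmic variables. *)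
Lemma listed_zero_bound f K rho A c : entire f -> f 0%C = 1%C -> zeros_listing f K rho ->
  Rbar_lt (growth f A) (Finite c) ->
  exists X0, 1 <= X0 /\ forall n, listed K n -> 0 < Cmod (rho n) /\
    forall x, X0 < x -> INR n * (x - ln (Cmod (rho n))) < c * Rpower x A.
Proof.
  intros Hf H0 Hrho Hgr.
  destruct (growth_lt f A c Hgr) as [c' [B [Hc' HB]]]. simpl in Hc'.
  exists (Rmax 1 (ln (Rmax B 1))). split; [apply Rmax_l|].
  intros n Hn. destruct (listing_factorization f K rho n Hf Hrho Hn) as [g [Hg E]].
  assert (Hn1 : (1 <= n)%nat) by apply Hn.
  assert (Hpos : 0 < Cmod (rho n)).
  { apply Cmod_gt_0. intros Hz. specialize (E (rho n)).
    rewrite root_product_In in E.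
    - rewrite Hz, H0, Cmult_0_l in E. now apply C1_nz.
    - apply in_map, in_seq. lia. }
  split; auto. intros x Hx.
  assert (Hxl : ln (Rmax B 1) < x) by (apply Rle_lt_trans with (2 := Hx); apply Rmax_r).
  assert (HBx : B < exp x).
  { apply Rle_lt_trans with (1 := Rmax_l B 1).
    rewrite <- (exp_ln (Rmax B 1)); [now apply exp_increasing|].
    generalize (Rmax_r B 1). lra. }
  assert (J := jensen_log f g (map rho (seq 1 n)) (Cmod (rho n)) (exp x) Hf H0 Hg E).
  rewrite length_map, length_seq, ln_exp in J.
  apply Rle_lt_trans with (ln (M (exp x) f)).
  - apply J; auto; [|apply exp_pos]. intros a Ha.
    apply in_map_iff in Ha. destruct Ha as [i [<- Hi]]. apply in_seq in Hi.
    apply (proj1 Hrho); auto; [|lia].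
    destruct Hn as [_ Hn]. split; [lia|]. destruct K; auto. lia.
  - apply Rlt_le_trans with (1 := HB _ HBx). rewrite ln_exp.
    apply Rmult_le_compat_r; auto. left; apply exp_pos.
Qed.

(** Here [x ^ A <= x], so [n (x - log |rho_n|) < c x] for all large [x], which
    is impossible when [n > c]. *)
Lemma few_zeros f K rho A c : entire f -> f 0%C = 1%C -> zeros_listing f K rho ->
  Rbar_lt (growth f A) (Finite c) -> 0 < c -> A <= 1 ->
  exists N, (1 <= N)%nat /\ forall n, (N <= n)%nat -> ~ listed K n.
Proof.
  intros Hf H0 Hrho Hgr Hc HA.
  destruct (listed_zero_bound f K rho A c Hf H0 Hrho Hgr) as [X0 [HX0 H]].
  destruct (INR_unbounded c) as [N HN].
  exists (S N). split; [lia|]. intros n Hn Hl.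
  destruct (H n Hl) as [_ Hb]. set (lam := ln (Cmod (rho n))) in *.
  assert (Hcn : c < INR n) by (apply Rlt_trans with (1 := HN); apply lt_INR; lia).
  set (x := Rmax (X0 + 1) (INR n * lam / (INR n - c))).
  assert (Hx1 : X0 + 1 <= x) by apply Rmax_l.
  assert (Hx2 : INR n * lam / (INR n - c) <= x) by apply Rmax_r.
  specialize (Hb x ltac:(lra)).
  assert (HP : Rpower x A <= x).
  { rewrite <- (Rpower_1 x) at 2 by lra. apply Rle_Rpower; lra. }
  apply Rle_div_l in Hx2; [|lra]. nra.
Qed.

(** Jensen's inequality at [x = lam / eta], where [lam] is the logarithm of the
    modulus, gives [n (1 - eta) < c (lam / eta)^(A - 1)]; it is applicable as soon
    as [lam] is large, and a fixed [x] shows that [lam] is large for large [n]. *)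
Lemma zeros_lower_bound f K rho A c eta :
  entire f -> f 0%C = 1%C -> zeros_listing f K rho ->
  Rbar_lt (growth f A) (Finite c) -> 0 < c -> 1 < A -> 0 < eta < 1 ->
  exists N, (1 <= N)%nat /\ forall n, (N <= n)%nat -> listed K n ->
    Cmod (rho n) >= exp (C_const eta A c * Rpower (INR n) (1 / (A - 1))).
Proof.
  intros Hf H0 Hrho Hgr Hc HA Heta.
  destruct (listed_zero_bound f K rho A c Hf H0 Hrho Hgr) as [X0 [HX0 H]].
  set (X1 := X0 + 1).
  destruct (INR_unbounded (c * Rpower X1 A / (X1 - eta * X0))) as [N HN].
  exists (S N). split; [lia|]. intros n Hn Hl.
  assert (Hn0 : INR N < INR n) by (apply lt_INR; lia).
  assert (Hnp : 0 < INR n) by (apply lt_0_INR; lia).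
  destruct (H n Hl) as [Hpos Hb]. set (lam := ln (Cmod (rho n))) in *.
  assert (HX : 0 < X1 - eta * X0) by (unfold X1; nra).
  assert (Hlam : eta * X0 < lam).
  { apply Rnot_le_lt. intros Hle. specialize (Hb X1 ltac:(unfold X1; lra)).
    apply Rlt_div_l in HN; auto. nra. }
  set (x := lam / eta).
  assert (Hx : X0 < x) by (unfold x; apply Rlt_div_r; lra).
  specialize (Hb x Hx).
  assert (Elam : lam = eta * x) by (unfold x; field; lra).
  assert (Hx0 : 0 < x) by lra.
  assert (HPx : Rpower x A = Rpower x (A - 1) * x).
  { rewrite <- (Rpower_1 x) at 3 by auto. rewrite <- Rpower_plus. f_equal. ring. }
  rewrite Elam, HPx in Hb.
  assert (Hb' : INR n * ((1 - eta) / c) < Rpower x (A - 1)).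
  { apply Rmult_lt_reg_r with (c * x); [nra|].
    replace (INR n * ((1 - eta) / c) * (c * x)) with (INR n * (x - eta * x)) by (field; lra).
    lra. }
  apply Rle_ge. rewrite <- (exp_ln (Cmod (rho n))) by auto. fold lam. apply exp_monotone.
  set (q := 1 / (A - 1)).
  assert (Hq : 0 < q) by (unfold q; apply Rdiv_lt_0_compat; lra).
  assert (HeA : 0 < Rpower eta A) by apply exp_pos.
  assert (Hc1 : 0 < (1 - eta) / c) by (apply Rdiv_lt_0_compat; lra).
  unfold C_const. fold q.
  rewrite Rpower_mult_distr; [|apply Rdiv_lt_0_compat; nra|auto].
  rewrite Elam.
  replace (eta * x) with (Rpower (Rpower (eta * x) (A - 1)) q).
  2:{ rewrite Rpower_mult. replace ((A - 1) * q) with 1 by (unfold q; field; lra).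
      apply Rpower_1. nra. }
  apply Rle_Rpower_l; [lra|]. split.
  - apply Rmult_lt_0_compat; auto. apply Rdiv_lt_0_compat; nra.
  - rewrite <- Rpower_mult_distr by lra.
    (* Jensen's inequality gives [eta ^ (A - 1)] where the constant has [eta ^ A] *)
    assert (He : Rpower eta A <= Rpower eta (A - 1)).
    { replace A with ((A - 1) + 1) at 1 by ring. rewrite Rpower_plus, Rpower_1 by lra.
      assert (0 < Rpower eta (A - 1)) by apply exp_pos. nra. }
    replace ((1 - eta) * Rpower eta A / c * INR n)
      with (Rpower eta A * (INR n * ((1 - eta) / c))) by (field; lra).
    apply Rmult_le_compat; try lra. nra.
Qed.

Theorem theorem2 (f : C -> C) (A : R)
  (f_entire : entire f) (f0 : f (RtoC 0) = RtoC 1)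
  (A_pos : 0 < A) (f_growth : Rbar_lt (growth f A) p_infty) :
  (~ is_polynomial f ->
   exists rho : nat -> C,
     zeros_listing f None rho /\
     forall n : nat, (1 <= n)%nat ->
       0 < Cmod (rho n) /\ Cmod (rho n) <= Cmod (rho (S n))) /\
  (forall (K : option nat) (rho : nat -> C), zeros_listing f K rho ->
   forall c : R, 0 < c -> Rbar_lt (growth f A) (Finite c) ->
     (A <= 1 ->
      exists N : nat, (1 <= N)%nat /\
        forall n : nat, (N <= n)%nat -> listed K n ->
          Cmod (rho n) >
            exp (2 * Rpower (2 * c) (1 / A) * Rpower (INR n) (1 / A))) /\
     (1 < A ->
      forall eta : R, 0 < eta < 1 ->
      exists N : nat, (1 <= N)%nat /\
        forall n : nat, (N <= n)%nat -> listed K n ->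
          Cmod (rho n) >=
            exp (C_const eta A c * Rpower (INR n) (1 / (A - 1))))).
Proof.
  split.
  - intros Hp. apply listing_exists; auto. intros g l Hg E.
    now apply (cofactor_has_zero f A g l).
  - intros K rho Hrho c Hc Hgr. split.
    + intros HA. destruct (few_zeros f K rho A c) as [N [HN H]]; auto.
      exists N. split; auto. intros n Hn Hl. now destruct (H n Hn).
    + intros HA eta Heta. now apply (zeros_lower_bound f K rho A c eta).
Qed.
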